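(* Let $R$ be a strong Mori domain. If $R$ is Boole $w$-regular, then the $w$-integral closure $R^{[w]}$ of $R$ is a unique factorization domain.
   Context: Let $R$ be an integral domain with field of fractions $K$. An ideal of $R$ means a nonzero fractional ideal; it is integral if it is contained in $R$. For $R$-submodules $I,J$ of $K$, $(J:I):=\{x\in K: xI\subseteq J\}$. For an ideal $I$: $I^v:=(R:(R:I))$; $I^t:=\bigcup\{J^v : J\subseteq I \text{ a finitely generated ideal}\}$; $I^w:=\bigcap_{M\in t\text{-}\mathrm{Max}(R)}IR_M$, where $t\text{-}\mathrm{Max}(R)$ is the set of maximal elements among the proper integral ideals with $I=I^t$ (they are prime). A $w$-ideal is an ideal with $I=I^w$. $R$ is strong Mori if it satisfies the ascending chain condition on integral $w$-ideals. $R$ is Boole $w$-regular if for every ideal $I$ of $R$ there is $0\ne x\in K$ with $(I^2)^w=xI^w$. The $w$-integral closure of $R$ is the overring $R^{[w]}:=\bigcup\{(J^w:J^w): J \text{ a finitely generated ideal of } R\}$. *)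

(* Defs.v *)
From mathcomp Require Import all_boot all_algebra.
From mathcomp Require Import boolp classical_sets.

Set Implicit Arguments.
Unset Strict Implicit.
Unset Printing Implicit Defensive.

Import GRing.Theory.

Local Open Scope classical_set_scope.
Local Open Scope ring_scope.

(* R is an idomainType, its field of fractions K is {fraction R}, and every
   subset of K is a term of type set {fraction R}. *)

Notation tofrac := (@FracField.tofrac _).

Definition base_ring (R : idomainType) : set {fraction R} :=
  [set tofrac r | r in [set: R]].
Arguments base_ring : clear implicits.

Definition is_submodule (R : idomainType) (I : set {fraction R}) : Prop :=
  [/\ I 0,
      forall x y, I x -> I y -> I (x + y)
    & forall (r : R) x, I x -> I (tofrac r * x)].

Definition is_ideal (R : idomainType) (I : set {fraction R}) : Prop :=
  [/\ is_submodule I,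
      exists2 x, I x & x != 0
    & exists2 d : R, d != 0 & forall x, I x -> base_ring R (tofrac d * x)].

Definition is_integral_ideal (R : idomainType) (I : set {fraction R}) : Prop :=
  is_ideal I /\ I `<=` base_ring R.

Definition span_of (R : idomainType) (s : seq {fraction R}) :
    set {fraction R} :=
  [set x | exists c : 'I_(size s) -> R,
     x = \sum_(i < size s) tofrac (c i) * s`_i].

Definition is_fg_ideal (R : idomainType) (I : set {fraction R}) : Prop :=
  is_ideal I /\ exists s : seq {fraction R}, I = span_of s.

Definition colon (R : idomainType) (J I : set {fraction R}) :
    set {fraction R} :=
  [set x | forall y, I y -> J (x * y)].

Definition prod_module (R : idomainType) (I J : set {fraction R}) :
    set {fraction R} :=
  [set x | exists2 s : seq ({fraction R} * {fraction R}),
     (forall p, p \in s -> I p.1 /\ J p.2)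
     & x = \sum_(p <- s) p.1 * p.2].

Definition v_closure (R : idomainType) (I : set {fraction R}) :
    set {fraction R} :=
  colon (base_ring R) (colon (base_ring R) I).

Definition t_closure (R : idomainType) (I : set {fraction R}) :
    set {fraction R} :=
  [set x | exists J, [/\ is_fg_ideal J, J `<=` I & v_closure J x]].

Definition is_proper_integral_t_ideal (R : idomainType)
    (I : set {fraction R}) : Prop :=
  [/\ is_integral_ideal I, I <> base_ring R & I = t_closure I].

Definition t_max (R : idomainType) : set (set {fraction R}) :=
  [set M | is_proper_integral_t_ideal M /\
     forall N, is_proper_integral_t_ideal N -> M `<=` N -> N = M].
Arguments t_max : clear implicits.

Definition localization (R : idomainType) (M : set {fraction R}) :
    set {fraction R} :=
  [set x | exists a s : R, ~ M (tofrac s) /\ x = tofrac a / tofrac s].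

(* If R is a field then t_max R is empty, and the intersection is K. *)
Definition w_closure (R : idomainType) (I : set {fraction R}) :
    set {fraction R} :=
  \bigcap_(M in t_max R) prod_module I (localization M).

Definition is_integral_w_ideal (R : idomainType) (I : set {fraction R}) :
    Prop :=
  is_integral_ideal I /\ I = w_closure I.

Definition strong_Mori (R : idomainType) : Prop :=
  forall I : nat -> set {fraction R},
    (forall n, is_integral_w_ideal (I n)) ->
    (forall n, I n `<=` I n.+1) ->
    exists N : nat, forall n : nat, (N <= n)%N -> I n = I N.

Definition Boole_w_regular (R : idomainType) : Prop :=
  forall I : set {fraction R}, is_ideal I ->
    exists2 x : {fraction R}, x != 0
      & w_closure (prod_module I I) = [set x * y | y in w_closure I].

Definition w_integral_closure (R : idomainType) : set {fraction R} :=
  \bigcup_(J in [set J : set {fraction R} | is_fg_ideal J])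
     colon (w_closure J) (w_closure J).
Arguments w_integral_closure : clear implicits.

Definition unit_in (K : fieldType) (S : set K) (x : K) : Prop :=
  S x /\ exists2 y, S y & x * y = 1.

Definition irreducible_in (K : fieldType) (S : set K) (x : K) : Prop :=
  [/\ S x, x != 0, ~ unit_in S x
    & forall a b, S a -> S b -> x = a * b -> unit_in S a \/ unit_in S b].

Definition associated_in (K : fieldType) (S : set K) (x y : K) : Prop :=
  exists2 u, unit_in S u & y = u * x.

Definition is_UFD (K : fieldType) (S : set K) : Prop :=
  [/\ GRing.subring_closed (mem S),
      forall x, S x -> x != 0 -> ~ unit_in S x ->
        exists2 s : seq K, (forall p, p \in s -> irreducible_in S p)
          & x = \prod_(p <- s) p
    & forall s t : seq K,
        (forall p, p \in s -> irreducible_in S p) ->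
        (forall p, p \in t -> irreducible_in S p) ->
        \prod_(p <- s) p = \prod_(p <- t) p ->
        exists t' : seq K,
          [/\ perm_eq t t', size s = size t'
            & forall i : nat, (i < size s)%N -> associated_in S s`_i t'`_i]].

(* Main.v *)
(* Write T for the w-integral closure. Localized at a t-maximal ideal, Boole
   w-regularity makes a suitable scaling J of I^w satisfy J J = J, so by the
   determinant trick J contains 1: every I^w is x S with S a fractional
   w-ideal that is an overring of R. Such overrings are directed with union T,
   and applying this to I = (a, b) shows that x is a gcd of a and b in T.
   For a t-maximal M = x S, the ring S / x S is locally Artinian; hence every
   nonzero c in R divides locally a power of x in S (so M has height one), and
   Kaplansky's argument for the Krull-Akizuki theorem gives, locally at M,
   T = x^-n S + x T. So the divisors of x in T satisfy the ascending chain
   condition and x is a product of irreducibles. By Noetherian induction,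
   through I |-> (I : M), every nonzero element of T divides a product of such
   generators x. *)
Require Import Defs.
From mathcomp Require Import all_boot all_algebra.
From mathcomp Require Import boolp classical_sets.
From mathcomp Require Import ring.

Set Implicit Arguments.
Unset Strict Implicit.
Unset Printing Implicit Defensive.

Import GRing.Theory.

Local Open Scope classical_set_scope.
Local Open Scope ring_scope.

(** * GCD domains inside a field and unique factorization *)

Section GcdDomain.
Variables (K : fieldType) (S : set K).
Hypotheses (S1 : S 1) (SB : forall x y, S x -> S y -> S (x - y))
  (SM : forall x y, S x -> S y -> S (x * y)).
Implicit Types (a b c p u v x y : K) (s t : seq K).

Definition all_irr s := forall p, p \in s -> irreducible_in S p.

(** The unit lets units factor with an empty [s] and keeps the predicate stable under products. *)
Definition factors y :=
  exists u s, [/\ unit_in S u, all_irr s & y = u * \prod_(p <- s) p].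

Lemma all_irr_cons p s : irreducible_in S p -> all_irr s -> all_irr (p :: s).
Proof. by move=> ip is_ q /predU1P[->|/is_]. Qed.

Lemma all_irr_head p s : all_irr (p :: s) -> irreducible_in S p.
Proof. by apply; rewrite mem_head. Qed.

Lemma all_irr_behead p s : all_irr (p :: s) -> all_irr s.
Proof. by move=> h q qs; apply: h; rewrite in_cons qs orbT. Qed.

Lemma all_irr_cat s t : all_irr s -> all_irr t -> all_irr (s ++ t).
Proof. by move=> hs ht p; rewrite mem_cat => /orP[/hs|/ht]. Qed.

Lemma unit1 : unit_in S 1.
Proof. by split=> //; exists 1; rewrite ?mulr1. Qed.

Lemma unitM u v : unit_in S u -> unit_in S v -> unit_in S (u * v).
Proof.
move=> [Su [u' Su' eu]] [Sv [v' Sv' ev]]; split; first exact: SM.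
by exists (u' * v'); [exact: SM|rewrite mulrACA eu ev mulr1].
Qed.

Lemma unit_neq0 u : unit_in S u -> u != 0.
Proof.
by move=> [_ [v _ e]]; apply/eqP => u0; move/eqP: e; rewrite u0 mul0r eq_sym oner_eq0.
Qed.

Lemma unitV u : unit_in S u -> unit_in S u^-1.
Proof.
move=> Uu; have u0 := unit_neq0 Uu; have [Su [v Sv e]] := Uu.
have -> : u^-1 = v by rewrite -[v]mul1r -(mulVf u0) -mulrA e mulr1.
by split=> //; exists u => //; rewrite mulrC.
Qed.

Lemma unit_factorl x y : S x -> S y -> unit_in S (x * y) -> unit_in S x.
Proof.
move=> Sx Sy [_ [v Sv e]]; split=> //; exists (y * v); first exact: SM.
by rewrite mulrA.
Qed.

Lemma prod_irr_mem s : all_irr s -> S (\prod_(p <- s) p).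
Proof. by move=> h; rewrite big_seq; apply: big_ind => // p /h[]. Qed.

Lemma irr_unitM u p : unit_in S u -> irreducible_in S p -> irreducible_in S (u * p).
Proof.
move=> Uu [Sp p0 np ip]; have u0 := unit_neq0 Uu; split.
- by apply: SM => //; case: Uu.
- by rewrite mulf_neq0.
- by move=> Up; apply: np; rewrite -(mulKf u0 p); apply: unitM => //; apply: unitV.
move=> a b Sa Sb e; have [|||Ub] := ip (u^-1 * a) b _ Sb.
- by apply: SM => //; case: (unitV Uu).
- by rewrite -mulrA -e mulKf.
- by move=> Ua; left; rewrite -(mulVKf u0 a); apply: unitM.
by right.
Qed.

Lemma factorsM x y : factors x -> factors y -> factors (x * y).
Proof.
move=> [u [s [Uu hs ->]]] [v [t [Uv ht ->]]]; exists (u * v), (s ++ t).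
by split; [exact: unitM|exact: all_irr_cat|rewrite big_cat mulrACA].
Qed.

Lemma factors_irr p : irreducible_in S p -> factors p.
Proof.
move=> ip; exists 1, [:: p]; split; [exact: unit1| |by rewrite big_seq1 mul1r].
by move=> q; rewrite inE => /eqP->.
Qed.

Lemma factors_unit u : unit_in S u -> factors u.
Proof. by move=> Uu; exists u, [::]; split=> //; rewrite big_nil mulr1. Qed.

Lemma factors_seq y : factors y -> ~ unit_in S y ->
  exists2 s, all_irr s & y = \prod_(p <- s) p.
Proof.
move=> [u [[|p s] [Uu hs ->]]]; first by rewrite big_nil mulr1.
move=> _; exists (u * p :: s); last by rewrite !big_cons mulrA.
apply: all_irr_cons; last exact: all_irr_behead hs.
by apply: irr_unitM => //; apply: all_irr_head hs.
Qed.

Hypothesis gcd : forall a b, a != 0 -> exists g,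
  [/\ g != 0, S (a / g), S (b / g)
    & forall c, c != 0 -> S (a / c) -> S (b / c) -> S (g / c)].

Lemma S0 : S 0.
Proof. by rewrite -(subrr 1); apply: SB. Qed.

Lemma irr_prime p a b : irreducible_in S p -> S a -> S b -> S (a * b / p) ->
  S (a / p) \/ S (b / p).
Proof.
move=> [Sp p0 np ip] Sa Sb h.
have [->|b0] := eqVneq b 0; first by right; rewrite mul0r; apply: S0.
have [g [g0 pg ag hg]] := gcd a p0.
have Sg : S g by rewrite -[g]divr1; apply: hg; rewrite ?oner_eq0 ?divr1.
have [|[_ [z Sz e]]|[_ [z Sz e]]] := ip g (p / g) Sg pg.
- by rewrite mulrC divfK.
(* The common divisor tested is the fraction [p / b]: it divides [p] with quotient [b] and [a] with
   quotient [a * b / p], hence it divides [g], which is a unit here. *)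
- right; have : S (g / (p / b)).
    apply: hg; first by rewrite mulf_neq0 ?invr_eq0.
      by rewrite invf_div mulrC divfK.
    by rewrite invf_div mulrA.
  move=> /(SM Sz); congr S; rewrite invf_div !mulrA [z * g]mulrC e mul1r //.
- left; have := SM ag Sz; congr S.
  have -> : z = g / p.
    by rewrite -[z](mulKf (x := p / g)) ?e ?mulr1 ?invf_div // mulf_neq0 ?invr_eq0.
  by rewrite mulrA divfK.
Qed.

(** Each [p] is prime by [irr_prime], so it cancels either from [x], where it is recorded as a
    factor, or from the cofactor [y]. *)
Lemma factors_dvd s u x y : all_irr s -> unit_in S u -> S x -> S y ->
  x * y = u * \prod_(p <- s) p -> factors x.
Proof.
elim: s u x y => [|p s IHs] u x y hs Uu Sx Sy.
  rewrite big_nil mulr1 => e; apply: factors_unit.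
  by apply: (unit_factorl Sx Sy); rewrite e.
have ip := all_irr_head hs; have hs' := all_irr_behead hs.
have [Sp p0 _ _] := ip.
rewrite big_cons mulrCA => e.
have [|xp|yp] := irr_prime ip Sx Sy.
- rewrite e mulrC mulKf //; apply: SM; [by case: Uu|exact: prod_irr_mem].
- rewrite -(divfK p0 x); apply: factorsM; last exact: factors_irr.
  by apply: (IHs u _ y) => //; apply: (mulfI p0); rewrite -e mulrA [p * _]mulrC divfK.
- apply: (IHs u _ (y / p)) => //; apply: (mulfI p0).
  by rewrite -e mulrCA [p * _]mulrC divfK.
Qed.

Lemma irr_dvd_unit p u : irreducible_in S p -> unit_in S u -> ~ S (u / p).
Proof.
move=> [Sp p0 np _] Uu h; apply: np.
apply: (@unit_factorl _ (u / p)) => //.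
by rewrite mulrC divfK.
Qed.

Lemma irr_dvd_prod p u t : irreducible_in S p -> unit_in S u -> all_irr t ->
  S (u * \prod_(q <- t) q / p) -> exists2 q, q \in t & S (q / p).
Proof.
move=> ip Uu; elim: t => [|q t IHt] ht.
  by rewrite big_nil mulr1 => /(irr_dvd_unit ip Uu).
have ht' := all_irr_behead ht; have [Sq _ _ _] := all_irr_head ht.
rewrite big_cons mulrCA => h; have [||/(IHt ht')[r rt rp]] := irr_prime ip Sq _ h.
- by apply: SM; [case: Uu|exact: prod_irr_mem].
- by move=> qp; exists q; rewrite ?mem_head.
by exists r => //; rewrite in_cons rt orbT.
Qed.

Lemma irr_dvd_irr p q : irreducible_in S p -> irreducible_in S q -> S (q / p) ->
  unit_in S (q / p).
Proof.
move=> [Sp p0 np _] [Sq q0 _ iq] qp.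
by have [|/np|] := iq p (q / p) Sp qp; first by rewrite mulrC divfK.
Qed.

(** The unit [u] absorbs the quotient [q / p] of the associates matched at each step of the
    induction. *)
Lemma unique_factorization u s t : unit_in S u -> all_irr s -> all_irr t ->
  \prod_(p <- s) p = u * \prod_(p <- t) p ->
  exists t', [/\ perm_eq t t', size s = size t'
    & forall i, (i < size s)%N -> associated_in S s`_i t'`_i].
Proof.
elim: s u t => [|p s IHs] u t Uu hs ht.
  case: t ht => [|q t] ht e; first by exists [::].
  have [Sq _ nq _] := all_irr_head ht; case: nq.
  apply: (@unit_factorl _ (u * \prod_(p <- t) p)) => //.
    by apply: SM; [case: Uu|apply/prod_irr_mem/all_irr_behead/ht].
  by move: e; rewrite big_nil big_cons mulrCA => <-; apply: unit1.
have ip := all_irr_head hs; have hs' := all_irr_behead hs.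
have [Sp p0 _ _] := ip; rewrite big_cons => e.
have [|q qt qp] := irr_dvd_prod ip Uu ht.
  by rewrite -e mulrC mulKf //; apply: prod_irr_mem.
have iq := ht q qt; have Uqp := irr_dvd_irr ip iq qp.
have tq := perm_to_rem qt.
have ht' : all_irr (rem q t) by move=> r /mem_rem/ht.
have [||t' [tt' st' ast']] := IHs (u * (q / p)) _ _ hs' ht'; first exact: unitM.
  by apply: (mulfI p0); rewrite e (perm_big _ tq) big_cons /=; field.
exists (q :: t'); split=> /=; [|by rewrite st'|].
  by rewrite (perm_trans tq) // perm_cons.
case=> [_|i /ast'//] /=; exists (q / p) => //.
by rewrite divfK.
Qed.

(** Irreducibles are prime in a GCD domain, so divisors of products of irreducibles factor;
    existence of factorizations thus reduces to the divisibility hypothesis. *)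
Lemma gcd_domain_UFD :
  (forall y, S y -> y != 0 -> exists2 s, all_irr s & S (\prod_(p <- s) p / y)) ->
  is_UFD S.
Proof.
move=> hdvd; split.
- by split=> [|x y|x y]; rewrite !inE //; [exact: SB|exact: SM].
- move=> y Sy y0 Uy; apply: factors_seq => //.
  have [s hs hy] := hdvd y Sy y0.
  apply: (@factors_dvd s 1 _ _ hs unit1 Sy hy).
  by rewrite mul1r mulrC divfK.
- move=> s t hs ht e; apply: (@unique_factorization 1) => //; first exact: unit1.
  by rewrite mul1r.
Qed.

End GcdDomain.

(** * Submodules of the fraction field, generators and denominators *)

Section Submodules.
Variable R : idomainType.
Local Notation K := {fraction R}.
Local Notation B := (base_ring R).
Implicit Types (I J D M : set K) (s : seq K) (x y z r : K).

Lemma base0 : B 0.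
Proof. by exists 0; rewrite ?rmorph0. Qed.

Lemma base1 : B 1.
Proof. by exists 1; rewrite ?rmorph1. Qed.

Lemma baseD x y : B x -> B y -> B (x + y).
Proof. by move=> [a _ <-] [b _ <-]; exists (a + b); rewrite ?rmorphD. Qed.

Lemma baseM x y : B x -> B y -> B (x * y).
Proof. by move=> [a _ <-] [b _ <-]; exists (a * b); rewrite ?rmorphM. Qed.

Lemma baseN x : B x -> B (- x).
Proof. by move=> [a _ <-]; exists (- a); rewrite ?rmorphN. Qed.

Lemma baseX x n : B x -> B (x ^+ n).
Proof.
move=> Bx; elim: n => [|n IHn]; first by rewrite expr0; apply: base1.
by rewrite exprS; apply: baseM.
Qed.

Lemma fractionP x : exists a b, [/\ B a, B b, b != 0 & x * b = a].
Proof.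
elim/generic_quotient.quotW: x => u.
exists (tofrac (u : R * R).1), (tofrac (u : R * R).2); split.
- by exists (u : R * R).1.
- by exists (u : R * R).2.
- by rewrite tofrac_eq0; case: u => -[].
unlock FracField.tofrac; rewrite -[LHS]FracField.pi_mul.
apply/generic_quotient.eqmodP; rewrite /= FracField.equivfE /FracField.mulf.
have u2 : (u : R * R).2 != 0 by case: u => -[].
by rewrite !numden_Ratio ?mulr1 ?oner_neq0 // mulrC.
Qed.

Lemma submod0 I : is_submodule I -> I 0.
Proof. by case. Qed.

Lemma submodD I x y : is_submodule I -> I x -> I y -> I (x + y).
Proof. by case=> _ + _; apply. Qed.

Lemma submodM I r x : is_submodule I -> B r -> I x -> I (r * x).
Proof. by case=> _ _ h [a _ <-]; apply: h. Qed.

Lemma submodN I x : is_submodule I -> I x -> I (- x).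
Proof. by move=> sI Ix; rewrite -mulN1r; apply: submodM => //; apply/baseN/base1. Qed.

Lemma submodB I x y : is_submodule I -> I x -> I y -> I (x - y).
Proof. by move=> sI Ix Iy; apply: submodD => //; apply: submodN. Qed.

Lemma submod_sum I (T : eqType) (t : seq T) (f : T -> K) : is_submodule I ->
  (forall i, i \in t -> I (f i)) -> I (\sum_(i <- t) f i).
Proof.
move=> sI h; rewrite big_seq; apply: big_ind => //; first exact: submod0.
by move=> x y; apply: submodD.
Qed.

Lemma submod_base : is_submodule B.
Proof.
split; [exact: base0|exact: baseD|by move=> r x Bx; apply: baseM; first by exists r].
Qed.

Lemma submodI1 D : is_submodule D -> D `<=` B -> D 1 -> D = B.
Proof.
move=> sD DB D1; apply/seteqP; split=> // x Bx.
by rewrite -[x]mulr1; apply: submodM.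
Qed.

Lemma submod_span s : is_submodule (span_of s).
Proof.
split.
- by exists (fun=> 0); rewrite big1 // => i _; rewrite rmorph0 mul0r.
- move=> x y [c ->] [d ->]; exists (fun i => c i + d i).
  by rewrite -big_split; apply: eq_bigr => i _; rewrite rmorphD mulrDl.
- move=> r x [c ->]; exists (fun i => r * c i).
  by rewrite mulr_sumr; apply: eq_bigr => i _; rewrite rmorphM mulrA.
Qed.

Lemma mem_span s x : x \in s -> span_of s x.
Proof.
move=> xs; have lt : (index x s < size s)%N by rewrite index_mem.
exists (fun i => (i == Ordinal lt)%:R).
rewrite (bigD1 (Ordinal lt)) //= eqxx rmorph1 mul1r nth_index // big1 ?addr0 //.
by move=> i /negPf->; rewrite rmorph0 mul0r.
Qed.

Lemma span_sub I s : is_submodule I -> (forall x, x \in s -> I x) ->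
  span_of s `<=` I.
Proof.
move=> sI h x [c ->]; apply: submod_sum => // i _.
by apply: submodM; [|exists (c i)|apply/h/mem_nth].
Qed.

Lemma common_denom s : exists d, [/\ B d, d != 0 & forall x, x \in s -> B (d * x)].
Proof.
elim: s => [|y s [d [Bd d0 h]]].
  by exists 1; split=> //; [exact: base1|exact: oner_neq0].
have [a [b [Ba Bb b0 e]]] := fractionP y.
exists (d * b); split; [exact: baseM|by rewrite mulf_neq0|].
move=> x; rewrite in_cons => /predU1P[->|xs].
  by rewrite -mulrA [b * y]mulrC e; apply: baseM.
by rewrite mulrAC mulrC; apply: baseM => //; apply: h.
Qed.

(** The last condition of [is_ideal], with the denominator taken in the fraction field instead of
    [R]. *)
Definition bounded I := exists d, [/\ B d, d != 0 & forall x, I x -> B (d * x)].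

Lemma is_idealP I : is_ideal I <->
  [/\ is_submodule I, exists2 x, I x & x != 0 & bounded I].
Proof.
split=> -[sI nI]; last first.
  by move=> [_ [[d _ <-] d0 h]]; split=> //; exists d; rewrite // -(tofrac_eq0 d).
move=> [d d0 h]; split=> //; exists (tofrac d).
by split=> //; [exists d|rewrite tofrac_eq0].
Qed.

Lemma bounded_span s : bounded (span_of s).
Proof.
have [d [Bd d0 h]] := common_denom s; exists d; split=> // x.
suff: span_of s `<=` [set x | B (d * x)] by apply.
apply: span_sub => //; split=> [|y z By Bz|r y By] /=.
- by rewrite mulr0; apply: base0.
- by rewrite mulrDr; apply: baseD.
- by rewrite mulrCA; apply: baseM => //; exists r.
Qed.

Lemma fg_ideal_span s x : x \in s -> x != 0 -> is_fg_ideal (span_of s).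
Proof.
move=> xs x0; split; last by exists s.
apply/is_idealP; split; [exact: submod_span| |exact: bounded_span].
by exists x => //; apply: mem_span.
Qed.

Lemma bounded_base D : D `<=` B -> bounded D.
Proof.
move=> DB; exists 1; split; [exact: base1|exact: oner_neq0|].
by move=> x /DB; rewrite mul1r.
Qed.

(* A Glaz-Vasconcelos generating set: [s] generates an integral ideal with
   inverse [R]. *)
Definition gv s := forall y, (forall r, r \in s -> B (y * r)) -> B y.

Definition no_gv D := forall s, (forall r, r \in s -> D r) -> ~ gv s.

Lemma gv_mul s t : gv s -> gv t -> gv [seq a * b | a <- s, b <- t].
Proof.
move=> gs gt y h; apply: gs => a sa; apply: gt => b tb.
by rewrite -mulrA; apply: h; apply: allpairs_f.
Qed.

(** * Families [gv], t-maximal ideals and their primality *)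

Definition no_gv_above D M :=
  [/\ is_submodule M, M `<=` B, D `<=` M & no_gv M].

(** Zorn's lemma applies because a [gv] family is finite: inside the union of a chain, it already
    lies in one member. *)
Lemma max_no_gv D : is_submodule D -> D `<=` B -> no_gv D ->
  exists2 M, no_gv_above D M & forall N, no_gv_above D N -> M `<=` N -> N = M.
Proof.
move=> sD DB nD.
pose P N := N = set0 \/ no_gv_above D N.
have [|M [PM maxM]] := @Zorn_bigcup _ P.
  move=> F FP tF.
  have [[N0 FN0 N0n]|none] := pselect (exists2 N, F N & N <> set0); last first.
    left; apply/seteqP; split=> // x [N FN Nx].
    have [N0|nN] := pselect (N = set0); first by rewrite N0 in Nx.
    by case: none; exists N.
  right.
  have FQ N x : F N -> N x -> no_gv_above D N.
    by move=> FN Nx; case: (FP _ FN) => // e; rewrite e in Nx.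
  have [x0 N0x] : exists x, N0 x.
    by apply: contrapT => h; apply: N0n; apply/seteqP; split=> // x Nx; case: h; exists x.
  have [sN0 N0B DN0 gN0] := FQ _ _ FN0 N0x.
  have fin s : (forall r, r \in s -> (\bigcup_(X in F) X) r) ->
      exists2 N, F N & (forall r, r \in s -> N r).
    elim: s => [|y s IHs] h; first by exists N0.
    have [N FN Ns] := IHs (fun r rs => h r (mem_behead (s := y :: s) rs)).
    have [N' FN' N'y] := h y (mem_head _ _).
    have [le|le] := tF _ _ FN FN'.
      by exists N' => // r /predU1P[->//|/Ns/le].
    by exists N => // r /predU1P[->|/Ns//]; apply: le.
  split.
  - split; first by exists N0 => //; apply: submod0.
    + move=> x y Ux Uy; have [|N FN Ns] := fin [:: x; y].
        by move=> r; rewrite !inE => /orP[]/eqP->.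
      have Nx : N x by apply: Ns; rewrite !inE eqxx.
      exists N => //; apply: submodD => //; first by case: (FQ _ _ FN Nx).
      by apply: Ns; rewrite !inE eqxx orbT.
    + move=> r x [N FN Nx]; exists N => //.
      by have [[_ _ h] _ _ _] := FQ _ _ FN Nx; apply: h.
  - by move=> x [N FN Nx]; have [_ h _ _] := FQ _ _ FN Nx; apply: h.
  - by move=> x Dx; exists N0 => //; apply: DN0.
  - move=> s /fin[N FN Ns].
    case: s Ns => [|y s] Ns; last first.
      by have [_ _ _ h] := FQ _ _ FN (Ns _ (mem_head _ _)); apply: h.
    by apply: (gN0 [::]).
have QM : no_gv_above D M.
  case: PM => // M0; have : P D by right; split.
  move/(maxM D); rewrite M0; case; split=> // h.
  by have /h := submod0 sD.
exists M => // N QN MN; apply: contrapT => ne.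
apply: (maxM N); last by right.
by split=> // NM; apply: ne; apply/seteqP.
Qed.

(** A [gv] family in [M], enlarged by a nonzero [e] so that it spans an ideal, has 1 in its
    v-closure, and this would force [M = B]. *)
Lemma proper_t_no_gv M : is_proper_integral_t_ideal M -> no_gv M.
Proof.
move=> [[/is_idealP[sM [e Me e0] _] MB] MnB Mt] s sM' gs; apply: MnB.
apply: submodI1 => //; rewrite Mt; exists (span_of (e :: s)); split.
- by apply: (@fg_ideal_span _ e) => //; rewrite mem_head.
- by apply: span_sub => // x /predU1P[->|/sM'].
- move=> y h; rewrite mul1r; apply: gs => r rs; apply: h.
  by apply: mem_span; rewrite in_cons rs orbT.
Qed.

(** A submodule [M] maximal without [gv] families is a t-ideal: if [x] is in [v_closure J] with [J]
    finitely generated in [M], then [M + B x] still has no such family and equals [M]. It is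
    t-maximal since no proper t-ideal contains such a family. *)
Lemma exists_t_max D : is_submodule D -> D `<=` B -> no_gv D ->
  (exists2 x, D x & x != 0) -> exists2 M, t_max R M & D `<=` M.
Proof.
move=> sD DB nD [e De e0].
have [M [sM MB DM nM] maxM] := max_no_gv sD DB nD.
have idM : is_ideal M.
  by apply/is_idealP; split=> //; [exists e => //; apply: DM|apply: bounded_base].
have MnB : M <> B.
  move=> MeB; apply: (nM [:: 1]) => [r|y h].
    by rewrite inE MeB => /eqP->; apply: base1.
  by rewrite -[y]mulr1; apply: h; rewrite inE.
exists M => //; split; last first.
  move=> N tN MN; apply: maxM => //; split.
  - by case: tN => -[[]].
  - by case: tN => -[].
  - exact: subset_trans MN.
  - exact: proper_t_no_gv.
split=> //; apply/seteqP; split=> x.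
  move=> Mx; exists (span_of [:: x; e]); split.
  - by apply: (@fg_ideal_span _ e) => //; rewrite !inE eqxx orbT.
  - by apply: span_sub => // y; rewrite !inE => /orP[]/eqP-> //; apply: DM.
  - by move=> y h; rewrite mulrC; apply: h; apply: mem_span; rewrite mem_head.
move=> [_ [[_ [s ->]] sM' Jx]].
pose N := [set y | exists m c, [/\ M m, B c & y = m + c * x]].
have MN : M `<=` N.
  by move=> m Mm; exists m, 0; split=> //; rewrite ?mul0r ?addr0 //; apply: base0.
have Bx : B x.
  rewrite -[x]mulr1; apply: Jx => y /sM'/MB; by rewrite mul1r.
suff <- : N = M.
  by exists 0, 1; split; [exact: submod0|exact: base1|rewrite add0r mul1r].
apply: maxM => //; split; last 1 first.
- move=> g gN gg.
  have gen : exists2 t : seq K, forall m, m \in t -> M m & forall r, r \in g ->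
     exists m c, [/\ m \in t, B c & r = m + c * x].
    elim: g gN {gg} => [|r g IHg] gN; first by exists [::].
    have [t tM ht] := IHg (fun r rs => gN r (mem_behead (s := _ :: _) rs)).
    have [m [c [Mm Bc e1]]] := gN _ (mem_head _ _).
    exists (m :: t) => [m' /predU1P[->|/tM]//|r'].
    move=> /predU1P[->|/ht[m' [c' [tm' Bc' e']]]].
      by exists m, c; rewrite mem_head.
    by exists m', c'; rewrite in_cons tm' orbT.
  have [t tM ht] := gen.
  (* If [y] carries [t ++ s] into [B], then [y] carries [J] into [B], so [x * y] is in [B]; hence
     [y] carries [g] into [B] and is in [B]. *)
  apply: (nM (t ++ s)).
    by move=> r; rewrite mem_cat => /orP[/tM//|rs]; apply: sM'; apply: mem_span.
  move=> y hy; have yx : B (x * y).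
    apply: Jx; apply: span_sub => [|r rs].
      split=> [|a b|a b] /=; first by rewrite mulr0; apply: base0.
      by rewrite mulrDr; apply: baseD.
      by rewrite mulrCA; apply: baseM; exists a.
    by apply: hy; rewrite mem_cat rs orbT.
  apply: gg => r /ht[m [c [tm Bc ->]]].
  rewrite mulrDr; apply: baseD; first by apply: hy; rewrite mem_cat tm.
  by rewrite mulrCA [y * x]mulrC; apply: baseM.
- split.
  + by apply: MN; apply: submod0.
  + move=> y z [m [c [Mm Bc ->]]] [m' [c' [Mm' Bc' ->]]].
    exists (m + m'), (c + c'); split; [exact: submodD|exact: baseD|ring].
  + move=> r y [m [c [Mm Bc ->]]]; exists (tofrac r * m), (tofrac r * c).
    by split; [apply: submodM => //; exists r|apply: baseM => //; exists r|ring].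
- by move=> y [m [c [Mm Bc ->]]]; apply: baseD; [exact: MB|apply: baseM].
- exact: subset_trans MN.
Qed.

Lemma t_max_no_gv M : t_max R M -> no_gv M.
Proof. by case=> /proper_t_no_gv. Qed.

Lemma t_max_submod M : t_max R M -> is_submodule M.
Proof. by case=> -[[[]]]. Qed.

Lemma t_max_base M : t_max R M -> M `<=` B.
Proof. by case=> -[[]]. Qed.

Lemma t_max_neq1 M : t_max R M -> ~ M 1.
Proof.
move=> tM M1; have [[_ MnB _] _] := tM; apply: MnB.
by apply: submodI1 => //; [exact: t_max_submod|exact: t_max_base].
Qed.

Lemma t_max_eq M N : t_max R M -> t_max R N -> M `<=` N -> N = M.
Proof. by move=> [_ h] [tN _]; apply: h. Qed.

(** Otherwise [M + B r] would lie in a t-maximal ideal, necessarily [M], which would then contain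
    [r]. *)
Lemma t_max_gv_add M r : t_max R M -> B r -> ~ M r ->
  exists2 g, gv g & forall a, a \in g -> exists m c, [/\ M m, B c & a = m + c * r].
Proof.
move=> tM Br Mr; apply: contrapT => no.
have sM := t_max_submod tM; have MB := t_max_base tM.
pose N := [set y | exists m c, [/\ M m, B c & y = m + c * r]].
have MN : M `<=` N.
  by move=> m Mm; exists m, 0; split=> //; rewrite ?mul0r ?addr0 //; apply: base0.
have [||||M' tM' NM'] := @exists_t_max N.
- split.
  + by apply: MN; apply: submod0.
  + move=> y z [m [c [Mm Bc ->]]] [m' [c' [Mm' Bc' ->]]].
    exists (m + m'), (c + c'); split; [exact: submodD|exact: baseD|ring].
  + move=> b y [m [c [Mm Bc ->]]]; exists (tofrac b * m), (tofrac b * c).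
    by split; [apply: submodM => //; exists b|apply: baseM => //; exists b|ring].
- by move=> y [m [c [Mm Bc ->]]]; apply: baseD; [exact: MB|apply: baseM].
- by move=> g gN gg; apply: no; exists g.
- exists r; last by apply: contra_notN Mr => /eqP->; apply: submod0.
  by exists 0, 1; split; [exact: submod0|exact: base1|rewrite add0r mul1r].
apply: Mr; rewrite -(t_max_eq tM tM'); last exact: subset_trans NM'.
by apply: NM'; exists 0, 1; split; [exact: submod0|exact: base1|rewrite add0r mul1r].
Qed.

(** If neither factor were in [M], the products of a [gv] family in [M + B x] with one in [M + B y]
    would form a [gv] family inside [M]. *)
Lemma t_max_prime M x y : t_max R M -> B x -> B y -> M (x * y) -> M x \/ M y.
Proof.
move=> tM Bx By Mxy; apply: contrapT => /not_orP[Mx My].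
have sM := t_max_submod tM; have MB := t_max_base tM.
have [g gg hg] := t_max_gv_add tM Bx Mx.
have [h gh hh] := t_max_gv_add tM By My.
apply: (t_max_no_gv tM _ (gv_mul gg gh)) => _ /allpairsP[[a b] /= [ag bh ->]].
have [m [c [Mm Bc ->]]] := hg a ag; have [n [d [Mn Bd ->]]] := hh b bh.
rewrite mulrDl; apply: submodD => //.
  rewrite mulrC; apply: submodM => //.
  by apply: baseD; [exact: MB|apply: baseM].
rewrite mulrDr; apply: submodD => //; first by apply: submodM => //; apply: baseM.
by rewrite mulrACA; apply: submodM => //; apply: baseM.
Qed.

(** * Localization at t-maximal ideals and the w-closure *)

Definition outside M r := B r /\ ~ M r.

Lemma outside1 M : t_max R M -> outside M 1.
Proof. by move=> tM; split; [exact: base1|exact: t_max_neq1]. Qed.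

Lemma outsideM M x y : t_max R M -> outside M x -> outside M y -> outside M (x * y).
Proof.
move=> tM [Bx Mx] [By My]; split; first exact: baseM.
by case/(t_max_prime tM Bx By).
Qed.

Lemma outsideX M x n : t_max R M -> outside M x -> outside M (x ^+ n).
Proof.
move=> tM ox; elim: n => [|n IHn]; first by rewrite expr0; apply: outside1.
by rewrite exprS; apply: outsideM.
Qed.

Lemma outsideD M x y : t_max R M -> outside M x -> M y -> outside M (x - y).
Proof.
move=> tM [Bx Mx] My; split.
  by apply: baseD => //; apply: baseN; apply: (t_max_base tM).
move=> Mxy; apply: Mx; rewrite -(subrK y x).
by apply: submodD => //; apply: t_max_submod.
Qed.

Lemma outside_neq0 M x : t_max R M -> outside M x -> x != 0.
Proof.
move=> tM [_ Mx]; apply: contra_notN Mx => /eqP->.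
by apply: submod0; apply: t_max_submod.
Qed.

(** The localization of [I] at [M], described elementwise; [lw] is then the w-closure, by [lwE]. *)
Definition loc_at M I := [set y | exists2 r, outside M r & I (r * y)].

Definition lw I := [set y | forall M, t_max R M -> loc_at M I y].

Lemma loc_at_all M I (T : eqType) (t : seq T) (f : T -> K) :
  t_max R M -> is_submodule I -> (forall i, i \in t -> loc_at M I (f i)) ->
  exists2 r, outside M r & forall i, i \in t -> I (r * f i).
Proof.
move=> tM sI; elim: t => [|i t IHt] h; first by exists 1 => //; apply: outside1.
have [r or hr] := IHt (fun j jt => h j (mem_behead (s := _ :: _) jt)).
have [r' or' hr'] := h i (mem_head _ _).
exists (r * r'); first exact: outsideM.
move=> j /predU1P[->|/hr Ij].
  by rewrite -mulrA; apply: submodM => //; case: or.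
by rewrite mulrAC mulrC; apply: submodM => //; case: or'.
Qed.

Lemma sub_loc_at M I : t_max R M -> I `<=` loc_at M I.
Proof. by move=> tM x Ix; exists 1; rewrite ?mul1r //; apply: outside1. Qed.

Lemma sub_lw I : I `<=` lw I.
Proof. by move=> x Ix M tM; apply: sub_loc_at. Qed.

Lemma loc_atS M I J : I `<=` J -> loc_at M I `<=` loc_at M J.
Proof. by move=> IJ x [r or Ir]; exists r => //; apply: IJ. Qed.

Lemma lwS I J : I `<=` J -> lw I `<=` lw J.
Proof. by move=> IJ x h M /h; apply: loc_atS. Qed.

Lemma loc_at_submod M I : t_max R M -> is_submodule I -> is_submodule (loc_at M I).
Proof.
move=> tM sI; split.
- by apply: sub_loc_at => //; apply: submod0.
- move=> x y Ix Iy.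
  have [|r or hr] := @loc_at_all M I _ [:: x; y] id tM sI.
    by move=> z; rewrite !inE => /orP[]/eqP->.
  exists r => //; rewrite mulrDr.
  by apply: submodD => //; apply: hr; rewrite !inE eqxx ?orbT.
- by move=> a x [r or Ir]; exists r => //; rewrite mulrCA; apply: submodM => //; exists a.
Qed.

Lemma lw_submod I : is_submodule I -> is_submodule (lw I).
Proof.
move=> sI; split.
- by apply: sub_lw; apply: submod0.
- by move=> x y Ix Iy M tM; apply: submodD; [exact: loc_at_submod|exact: Ix|exact: Iy].
- by move=> a x Ix M tM; apply: submodM; [exact: loc_at_submod|exists a|exact: Ix].
Qed.

Lemma loc_at_id M I : t_max R M -> loc_at M (loc_at M I) `<=` loc_at M I.
Proof.
move=> tM x [r or [r' or' Ix]]; exists (r' * r); first exact: outsideM.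
by rewrite -mulrA.
Qed.

Lemma lw_loc M I : t_max R M -> lw I `<=` loc_at M I.
Proof. by move=> tM x; apply. Qed.

Lemma lw_id I : lw (lw I) `<=` lw I.
Proof.
move=> x h M tM; apply: loc_at_id => //.
by apply: (loc_atS (lw_loc tM)); apply: h.
Qed.

Lemma lwE I : is_submodule I -> w_closure I = lw I.
Proof.
move=> sI; apply/seteqP; split=> y h M tM.
  have [s hs ->] := h M tM.
  apply: submod_sum; first exact: loc_at_submod.
  move=> p /hs[Ip [a [b [Mb ->]]]].
  have b0 : tofrac b != 0 :> K.
    by apply: contra_notN Mb => /eqP->; apply: submod0; apply: t_max_submod.
  exists (tofrac b); first by split=> //; exists b.
  have -> : tofrac b * (p.1 * (tofrac a / tofrac b)) = tofrac a * p.1 :> K.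
    by rewrite mulrCA [tofrac b * _]mulrC divfK // mulrC.
  by apply: submodM => //; exists a.
have [r or Ir] := h M tM; have [[b _ be] Mr] := or.
have r0 := outside_neq0 tM or.
exists [:: (r * y, tofrac 1 / tofrac b)] => [p|].
  rewrite inE => /eqP -> /=; split=> //; exists 1, b; split=> //.
  by rewrite be.
by rewrite big_seq1 /= be rmorph1 div1r mulrAC divff ?mul1r.
Qed.

(** The conductor [D] of [y] into [B] is nonzero because [y] is a fraction. If [y] is not in [B], it
    contains no [gv] family, so it lies in some t-maximal [M], and [y] is not in the localization of
    [B] at [M]. *)
Lemma lw_base : lw B = B.
Proof.
apply/seteqP; split; last exact: sub_lw.
move=> y hy; pose D := [set r | B r /\ B (r * y)].
have [a [b [Ba Bb b0 e]]] := fractionP y.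
apply: contrapT => nBy.
have [||||M tM DM] := @exists_t_max D.
- split.
  + by split; rewrite ?mul0r; apply: base0.
  + move=> r s [Br Bry] [Bs Bsy].
    by split; rewrite ?mulrDl; apply: baseD.
  + move=> c r [Br Bry]; split; first by apply: baseM => //; exists c.
    by rewrite -mulrA; apply: baseM => //; exists c.
- by move=> r [].
- move=> g gD gg; apply: nBy; apply: gg => r /gD[_].
  by rewrite mulrC.
- by exists b => //; split; rewrite // mulrC e.
by have [r [Br Mr] Ir] := hy M tM; apply/Mr/DM.
Qed.

Lemma t_max_lw M : t_max R M -> lw M `<=` M.
Proof.
move=> tM y hy; have By : B y.
  by rewrite -lw_base; apply: lwS hy; apply: t_max_base.
have [r [Br Mr] My] := hy M tM.
by case: (t_max_prime tM Br By My).
Qed.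

End Submodules.

(** * Finiteness in strong Mori domains *)

Section StrongMori.
Variable R : idomainType.
Local Notation K := {fraction R}.
Local Notation B := (base_ring R).
Implicit Types (I J D M S E : set K) (s : seq K) (x y z r d : K).

Lemma lw_denom I d y : (forall x, I x -> B (d * x)) -> lw I y -> B (d * y).
Proof.
move=> h ly; rewrite -lw_base => M tM; have [r or Ir] := ly M tM.
by exists r => //; rewrite mulrCA; apply: h.
Qed.

Lemma bounded_lw I : bounded I -> bounded (lw I).
Proof. by move=> [d [Bd d0 h]]; exists d; split=> // x; apply: lw_denom. Qed.

Lemma prod_submod I J : is_submodule I -> is_submodule (prod_module I J).
Proof.
move=> sI; split.
- by exists [::]; rewrite ?big_nil.
- move=> x y [s hs ->] [t ht ->]; exists (s ++ t); rewrite ?big_cat // => p.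
  by rewrite mem_cat => /orP[/hs|/ht].
- move=> a x [s hs ->]; exists [seq (tofrac a * p.1, p.2) | p <- s].
    move=> _ /mapP[p /hs[Ip Jp] ->]; split=> //=.
    by apply: submodM => //; exists a.
  by rewrite big_map mulr_sumr; apply: eq_bigr => p _; rewrite mulrA.
Qed.

Lemma mem_prod I J x y : I x -> J y -> prod_module I J (x * y).
Proof.
move=> Ix Jy; exists [:: (x, y)]; rewrite ?big_seq1 // => p.
by rewrite inE => /eqP->.
Qed.

Lemma prod_sub I J D : is_submodule D -> (forall x y, I x -> J y -> D (x * y)) ->
  prod_module I J `<=` D.
Proof.
by move=> sD h x [s hs ->]; apply: submod_sum => // p /hs[]; apply: h.
Qed.

Lemma lw_mul I J D : is_submodule D -> (forall x y, I x -> J y -> D (x * y)) ->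
  forall x y, lw I x -> lw J y -> lw D (x * y).
Proof.
move=> sD h x y Ix Jy M tM.
have [r or Ir] := Ix M tM; have [r' or' Jr] := Jy M tM.
by exists (r * r'); [exact: outsideM|rewrite mulrACA; apply: h].
Qed.

Hypothesis hSM : strong_Mori R.

(** Multiplication by the common denominator [d] turns a strictly increasing chain in [C] into a
    chain of integral w-ideals, which must stop. *)
Lemma noetherian_max (C : set (set K)) I0 d : C I0 -> B d -> d != 0 ->
  (forall I, C I -> [/\ is_submodule I, lw I `<=` I, exists2 x, I x & x != 0
     & forall x, I x -> B (d * x)]) ->
  exists2 I, C I & forall J, C J -> I `<=` J -> J = I.
Proof.
move=> C0 Bd d0 hC; apply: contrapT => nomax.
have /choice[f hf] : forall I, exists J, C I -> [/\ C J, I `<=` J & J <> I].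
  move=> I; have [CI|nCI] := pselect (C I); last by exists I.
  apply: contrapT => no; apply: nomax; exists I => // J CJ IJ.
  by apply: contrapT => ne; apply: no; exists J.
pose I_ n := iter n f I0.
have CI n : C (I_ n) by elim: n => //= n /hf[].
pose dI n := [set d * y | y in I_ n].
have dIP n y : dI n (d * y) -> I_ n y.
  by case=> z Iz /(mulfI d0) <-.
have [n|n|N /(_ N.+1 (leqnSn N)) e] := hSM (I := dI).
- have [sI lI [e Ie e0] BI] := hC _ (CI n).
  have sdI : is_submodule (dI n).
    split.
    + by exists 0; rewrite ?mulr0 //; apply: submod0.
    + move=> _ _ [x Ix <-] [y Iy <-]; exists (x + y); rewrite ?mulrDr //.
      exact: submodD.
    + move=> a _ [x Ix <-]; exists (tofrac a * x).
        by apply: submodM => //; exists a.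
      by rewrite mulrCA.
  have dIB : dI n `<=` B by move=> _ [x Ix <-]; apply: BI.
  split.
    split=> //; apply/is_idealP; split=> //; last exact: bounded_base.
    by exists (d * e); [exists e|rewrite mulf_neq0].
  rewrite lwE //; apply/seteqP; split; first exact: sub_lw.
  move=> y ly; exists (y / d); last by rewrite mulrC divfK.
  apply: lI => M tM; have [r or [z Iz ez]] := ly M tM.
  by exists r => //; rewrite mulrA -ez mulrC mulKf.
- move=> _ [x Ix <-]; exists x => //.
  by have [_ h _] := hf _ (CI n); apply: h.
have [_ le ne] := hf _ (CI N).
apply: ne; apply/seteqP; split=> // x Ix.
by apply: dIP; rewrite -e; exists x.
Qed.

(** A maximal w-closure of finitely many elements of [D] absorbs every further one. The nonzero [e]
    among the generators keeps these w-ideals nonzero, as [noetherian_max] requires. *)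
Lemma finite_type D : is_submodule D -> bounded D ->
  exists2 s, forall x, x \in s -> D x & D `<=` lw (span_of s).
Proof.
move=> sD [d [Bd d0 hd]].
have [[e De e0]|no] := pselect (exists2 x, D x & x != 0); last first.
  exists [::] => // x Dx; have [->|x0] := eqVneq x 0.
    by apply: sub_lw; apply: submod0; apply: submod_span.
  by case: no; exists x.
pose C := [set I | exists2 s, forall x, x \in s -> D x & I = lw (span_of (e :: s))].
have sub s t : {subset s <= t} -> lw (span_of s) `<=` lw (span_of t).
  move=> st; apply: lwS; apply: span_sub; first exact: submod_span.
  by move=> x /st; apply: mem_span.
have [||_ [s sD' ->] maxs] := @noetherian_max C (lw (span_of [:: e])) d _ Bd d0.
- by exists [::].
- move=> _ [s sD' ->]; split.
  + by apply: lw_submod; apply: submod_span.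
  + exact: lw_id.
  + by exists e => //; apply: sub_lw; apply: mem_span; rewrite mem_head.
  + move=> x; apply: lw_denom => y Iy; apply: hd; apply: span_sub Iy => //.
    by move=> z /predU1P[->|/sD'].
exists (e :: s) => [x /predU1P[->|/sD']//|x Dx].
rewrite -(maxs (lw (span_of (e :: x :: s)))).
- by apply: sub_lw; apply: mem_span; rewrite !inE eqxx orbT.
- by exists (x :: s) => // y /predU1P[->|/sD'].
- by apply: sub => y; rewrite !inE => /orP[->|->]; rewrite ?orbT.
Qed.

(** * Overrings that are fractional w-ideals, and the determinant trick *)

Definition over S := [/\ is_submodule S, S 1, forall x y, S x -> S y -> S (x * y),
  lw S `<=` S & bounded S].

Section Congruence.
Variables (E : set K) (sE : is_submodule E).
Hypothesis mE : forall x y, E x -> E y -> E (x * y).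

(** [E] may reach outside [B], so only the right-hand side is asked to be in [B], and [congM] uses
    that [E] is closed under products. *)
Let cong x y := B y /\ E (x - y).

Let congD x y x' y' : cong x y -> cong x' y' -> cong (x + x') (y + y').
Proof.
move=> [By Exy] [By' Exy']; split; first exact: baseD.
by rewrite opprD addrACA; apply: submodD.
Qed.

Let congM x y x' y' : cong x y -> cong x' y' -> cong (x * x') (y * y').
Proof.
move=> [By Exy] [By' Exy']; split; first exact: baseM.
have -> : x * x' - y * y' = (x - y) * (x' - y') + y * (x' - y') + y' * (x - y).
  by ring.
by apply: submodD => //; [apply: submodD => //; [exact: mE|]|]; apply: submodM.
Qed.

Let cong_id x : B x -> cong x x.
Proof. by move=> Bx; split=> //; rewrite subrr; apply: submod0. Qed.

Lemma det_congruence n (A : 'M[K]_n) r : B r -> (forall i j, E (A i j)) ->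
  E (\det (r%:M - A) - r ^+ n).
Proof.
move=> Br EA; rewrite -(det_scalar n r).
suff [] : cong (\det (r%:M - A)) (\det (r%:M : 'M_n)) by [].
rewrite /determinant; apply: big_ind2 => [||p _]; [exact/cong_id/base0|exact: congD|].
apply: congM; first by apply: cong_id; apply: baseX; apply: baseN; apply: base1.
apply: big_ind2 => [||i _]; [exact/cong_id/base1|exact: congM|].
rewrite !mxE; split; last by rewrite addrAC subrr add0r; apply: submodN.
by case: eqP => _; rewrite ?mulr1n ?mulr0n //; apply: base0.
Qed.

End Congruence.

Lemma det_base n (A : 'M[K]_n) : (forall i j, B (A i j)) -> B (\det A).
Proof.
move=> BA; rewrite /determinant; apply: big_ind => [||p _]; [exact: base0|exact: baseD|].
apply: baseM; first by apply: baseX; apply: baseN; apply: base1.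
by apply: big_ind => [||i _]; [exact: base1|exact: baseM|].
Qed.

Lemma adj_base n (A : 'M[K]_n) i j : (forall i j, B (A i j)) -> B ((\adj A) i j).
Proof.
move=> BA; rewrite mxE /cofactor; apply: baseM.
  by apply: baseX; apply: baseN; apply: base1.
by apply: det_base => k l; rewrite !mxE.
Qed.

(** Determinant trick at [M]: as [J] is locally finitely generated and equal to [J J], some [r]
    outside [M] satisfies [r s = A s] with [A] over [J]. So [det (r - A)] vanishes; it is congruent
    to a power of [r] modulo [J], so that power is in [J]. *)
Lemma idempotent_1 J : is_submodule J -> bounded J -> (exists2 x, J x & x != 0) ->
  lw J `<=` J -> (forall x y, J x -> J y -> J (x * y)) ->
  J `<=` lw (prod_module J J) -> J 1.
Proof.
move=> sJ bJ [e Je e0] lJ mJ idJ; apply: lJ => M tM.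
have [s sJ' Js] := finite_type sJ bJ.
(* [L] is the product of [J] with the span of [s], written with coefficients in [J] on these fixed
   generators. *)
pose L := [set y | exists2 a : 'I_(size s) -> K, forall i, J (a i)
  & y = \sum_(i < size s) a i * s`_i].
have sL : is_submodule L.
  split.
  - exists (fun=> 0) => [i|]; first exact: submod0.
    by rewrite big1 // => i _; rewrite mul0r.
  - move=> x y [a Ja ->] [b Jb ->]; exists (fun i => a i + b i) => [i|].
      exact: submodD.
    by rewrite -big_split; apply: eq_bigr => i _; rewrite mulrDl.
  - move=> r x [a Ja ->]; exists (fun i => tofrac r * a i) => [i|].
      by apply: submodM => //; exists r.
    by rewrite mulr_sumr; apply: eq_bigr => i _; rewrite mulrA.
have JL y : J y -> loc_at M L y.
  move=> /idJ/(_ M tM)[r or [p hp e1]]; apply: loc_at_id => //; exists r => //.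
  rewrite e1; apply: submod_sum; first exact: loc_at_submod.
  move=> [a b] /hp /= [Ja /Js/(_ M tM)[r' or' [c e2]]]; exists r' => //.
  exists (fun i => a * tofrac (c i)) => [i|].
    by rewrite mulrC; apply: submodM => //; exists (c i).
  by rewrite mulrCA e2 mulr_sumr; apply: eq_bigr => i _; rewrite mulrA.
have [r or hr] := @loc_at_all _ M L _ s id tM sL (fun i si => JL i (sJ' i si)).
have /choice[A hA] : forall i : 'I_(size s), exists a : 'I_(size s) -> K,
    (forall j, J (a j)) /\ r * s`_i = \sum_j a j * s`_j.
  by move=> i; have [a Ja ea] := hr s`_i (mem_nth _ (ltn_ord i)); exists a.
pose Am := \matrix_(i, j) A i j; pose V := \col_(i < size s) s`_i.
have AV : (r%:M - Am) *m V = 0.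
  apply/matrixP => i j; rewrite mulmxBl mul_scalar_mx !mxE (hA i).2.
  apply/eqP; rewrite subr_eq0; apply/eqP/eq_bigr => k _.
  by rewrite !mxE.
have dV i : \det (r%:M - Am) * V i ord0 = 0.
  have := congr1 (fun W => (\adj (r%:M - Am) *m W) i ord0) AV.
  by rewrite mulmxA mul_adj_mx mul_scalar_mx mulmx0 !mxE.
(* A nonzero generator lets the determinant be cancelled; one exists because [e] is locally a
   combination of them. *)
have [i si0] : exists i : 'I_(size s), s`_i != 0.
  apply: contrapT => /forallNP h; have [r' or' [c e1]] := Js e Je M tM.
  move/eqP: e1; rewrite big1 ?mulf_eq0 ?(negPf e0) ?(negPf (outside_neq0 tM or')) //.
  by move=> i _; have /negP := h i; rewrite negbK => /eqP->; rewrite mulr0.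
have det0 : \det (r%:M - Am) = 0.
  by move/eqP: (dV i); rewrite mxE mulf_eq0 (negPf si0) orbF => /eqP.
have EA i' j : J (Am i' j) by rewrite mxE; apply: (hA i').1.
have := det_congruence sJ mJ or.1 EA.
rewrite det0 sub0r => /(submodN sJ); rewrite opprK => Jr.
by exists (r ^+ size s); [exact: outsideX|rewrite mulr1].
Qed.

(** Modulo [M] the determinant of [r - x A] is a power of [r], hence it is outside [M]; the adjugate
    shows that it carries every generator into [Q]. *)
Lemma nakayama M Q s x : t_max R M -> is_submodule Q -> M x ->
  (forall y, y \in s ->
     loc_at M [set y | exists q z, [/\ Q q, span_of s z & y = q + x * z]] y) ->
  forall y, y \in s -> loc_at M Q y.
Proof.
move=> tM sQ Mx h; set L := [set _ | _] in h.
have Bx := t_max_base tM Mx; have sM := t_max_submod tM.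
have sL : is_submodule L.
  split.
  - exists 0, 0; split; [exact: submod0| |by rewrite mulr0 addr0].
    by apply: submod0; apply: submod_span.
  - move=> _ _ [q [z [Qq sz ->]]] [q' [z' [Qq' sz' ->]]].
    exists (q + q'), (z + z'); split; [exact: submodD| |ring].
    by apply: submodD => //; apply: submod_span.
  - move=> a _ [q [z [Qq sz ->]]]; exists (tofrac a * q), (tofrac a * z).
    split; [by apply: submodM => //; exists a| |ring].
    by apply: submodM => //; [exact: submod_span|exists a].
have [r or hr] := @loc_at_all _ M L _ s id tM sL h.
have /choice[A hA] : forall i : 'I_(size s), exists a : 'I_(size s) -> R,
    Q (r * s`_i - x * \sum_j tofrac (a j) * s`_j).
  move=> i; have [q [z [Qq [a ->] ->]]] := hr s`_i (mem_nth _ (ltn_ord i)).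
  by exists a; rewrite addrK.
pose Am := \matrix_(i, j) (tofrac (A i j) * x); pose V := \col_(i < size s) s`_i.
have EA i j : M (Am i j) by rewrite mxE; apply: submodM => //; exists (A i j).
have BrA i j : B ((r%:M - Am) i j).
  rewrite !mxE; apply: baseD.
    by case: eqP => _; rewrite ?mulr1n ?mulr0n; [case: or|exact: base0].
  by apply: baseN; apply: (baseM _ Bx); exists (A i j).
move=> _ /(nthP 0)[i lt <-]; pose i' := Ordinal lt.
have mM a b : M a -> M b -> M (a * b).
  by move=> Ma Mb; apply: submodM => //; apply: (t_max_base tM).
have := det_congruence sM mM or.1 EA; set dt := \det _ => Edt.
exists dt.
  have -> : dt = r ^+ size s - (r ^+ size s - dt) by ring.
  apply: outsideD => //; first exact: outsideX.
  by rewrite -opprB; apply: submodN.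
have -> : dt * s`_i = (\adj (r%:M - Am) *m ((r%:M - Am) *m V)) i' ord0.
  by rewrite mulmxA mul_adj_mx mul_scalar_mx !mxE.
rewrite mxE; apply: submod_sum => // j _; apply: submodM => //; first exact: adj_base.
rewrite mulmxBl mul_scalar_mx !mxE.
have := hA j; rewrite mulr_sumr; congr (Q (_ - _)); apply: eq_bigr => k _.
by rewrite !mxE; ring.
Qed.

Hypothesis hB : Boole_w_regular R.

(** The ring is [S = x^-1 I^w]: regularity says that [S S] and [S] have the same w-closure, so [S]
    is closed under products and [idempotent_1] applies. *)
Lemma boole_over I : is_ideal I ->
  exists x S, [/\ x != 0, over S & forall y, lw I (x * y) <-> S y].
Proof.
move=> idI; have [x x0 ex] := hB idI.
have /is_idealP[sI [e Ie e0] bI] := idI.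
have sII := prod_submod I sI.
have II y : lw (prod_module I I) y <-> lw I (y / x).
  rewrite -lwE // ex lwE //; split=> [[z lz <-]|h].
    by rewrite mulrC mulKf.
  by exists (y / x) => //; rewrite mulrC divfK.
pose S := [set y | lw I (x * y)].
have sS : is_submodule S.
  have sl := lw_submod sI; split; rewrite /S /=.
  - by rewrite mulr0; apply: (submod0 sl).
  - by move=> y z Sy Sz; rewrite mulrDr; apply: (submodD sl).
  - by move=> r y Sy; rewrite mulrCA; apply: (submodM sl) => //; exists r.
have bS : bounded S.
  have [d [Bd d0 hd]] := bounded_lw bI.
  have [a [b [Ba Bb b0 e1]]] := fractionP (d * x).
  have dx0 : d * x != 0 by apply: mulf_neq0.
  exists a; split=> [//||y Sy]; first by rewrite -e1; apply: mulf_neq0.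
  by rewrite -e1 mulrAC mulrC -mulrA; apply: baseM => //; apply: hd.
have lS : lw S `<=` S.
  move=> y ly; apply: lw_id => M tM; have [r or Sr] := ly M tM.
  by exists r => //; rewrite mulrCA.
have mS y z : S y -> S z -> S (y * z).
  move=> Sy Sz; rewrite /S /=.
  have -> : x * (y * z) = (x * y) * (x * z) / x.
    by rewrite [x * y * _]mulrCA [x * (x * y * z)]mulrC mulfK // mulrA.
  by apply/II; apply: lw_mul Sy Sz => // a b; apply: mem_prod.
exists x, S; split=> //; split=> //.
apply: idempotent_1 => //.
  exists (e / x); last by rewrite mulf_neq0 ?invr_eq0.
  by rewrite /S /= mulrC divfK //; apply: sub_lw.
move=> y Sy M tM.
(* Locally [x * (x * y)] is a sum of products of two elements of [I]; dividing each factor by [x]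
   puts it in [S]. *)
have /II/(_ M tM) [r or [t ht et]] : lw I (x * (x * y) / x) by rewrite mulrC mulKf.
exists r => //; exists [seq (p.1 / x, p.2 / x) | p <- t].
  move=> _ /mapP[p /ht[I1 I2] ->]; split; rewrite /S /= mulrC divfK //; exact: sub_lw.
rewrite big_map; transitivity (r * (x * (x * y)) / (x * x)).
  by rewrite [x * (x * y)]mulrA [x * x * y]mulrC mulrA mulfK ?mulf_neq0.
by rewrite et mulr_suml; apply: eq_bigr => p _ /=; rewrite invfM mulrACA.
Qed.

End StrongMori.

(** * The union of the w-overrings: w-integral closure and gcds *)

Section ClosureRing.
Variable R : idomainType.
Local Notation K := {fraction R}.
Local Notation B := (base_ring R).
Implicit Types (I J D M S : set K) (s : seq K) (x y z r d : K).

Definition over_union := [set y : K | exists2 S, over S & S y].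
Local Notation T := over_union.

Lemma colon_submod I J : is_submodule J -> is_submodule (colon J I).
Proof.
move=> sJ; split => [y Iy|a b Ja Jb y Iy|r a Ja y Iy].
- by rewrite mul0r; apply: submod0.
- by rewrite mulrDl; apply: submodD => //; [exact: Ja|exact: Jb].
- by rewrite -mulrA; apply: submodM => //; [exists r|exact: Ja].
Qed.

Lemma lw_colon I J : lw J `<=` J -> lw (colon J I) `<=` colon J I.
Proof.
move=> lJ y ly z Iz; apply: lJ => M tM; have [r or h] := ly M tM.
by exists r => //; rewrite mulrA; apply: h.
Qed.

Lemma over_base : over B.
Proof.
split; [exact: submod_base|exact: base1|exact: baseM|by rewrite lw_base|].
exact: bounded_base.
Qed.

Lemma over_sub_base S : over S -> B `<=` S.
Proof. by move=> [sS S1 _ _ _] x Bx; rewrite -[x]mulr1; apply: submodM. Qed.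

Lemma over_join S S' : over S -> over S' ->
  exists S'', [/\ over S'', S `<=` S'' & S' `<=` S''].
Proof.
move=> [sS S1 mS lS [d [Bd d0 hd]]] [sS' S1' mS' lS' [d' [Bd' d0' hd']]].
pose P := prod_module S S'; have sP : is_submodule P by apply: prod_submod.
exists (lw P); split; first split.
- exact: lw_submod.
- by apply: sub_lw; rewrite -[1]mulr1; apply: mem_prod.
- apply: lw_mul => // x y Px Py.
  (* A colon into [P] is a submodule, so closure under products can be checked on the generators of
     [P], one factor at a time. *)
  suff : P `<=` colon P P by move/(_ x Px); apply.
  apply: (prod_sub (colon_submod _ sP)) => a b Sa Sb z Pz.
  rewrite mulrC; suff : P `<=` colon P [set a * b] by move/(_ z Pz); apply.
  apply: (prod_sub (colon_submod _ sP)) => a' b' Sa' Sb' _ ->.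
  by rewrite mulrACA; apply: mem_prod; [apply: mS|apply: mS'].
- exact: lw_id.
- apply: bounded_lw; exists (d * d'); split; [exact: baseM|by rewrite mulf_neq0|].
  move=> x [s hs ->]; rewrite mulr_sumr; apply: submod_sum; first exact: submod_base.
  by move=> p /hs[Sp Sp']; rewrite mulrACA; apply: baseM; [apply: hd|apply: hd'].
- by move=> x Sx; apply: sub_lw; rewrite -[x]mulr1; apply: mem_prod.
- by move=> x Sx; apply: sub_lw; rewrite -[x]mul1r; apply: mem_prod.
Qed.

Lemma over_common s : (forall x, x \in s -> T x) ->
  exists2 S, over S & forall x, x \in s -> S x.
Proof.
elim: s => [|y s IHs] h; first by exists B => //; apply: over_base.
have [S oS hS] := IHs (fun x xs => h x (mem_behead (s := _ :: _) xs)).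
have [S' oS' S'y] := h y (mem_head _ _).
have [S'' [oS'' SS SS']] := over_join oS oS'.
by exists S'' => // x /predU1P[->|/hS/SS//]; apply: SS'.
Qed.

Lemma over_common2 x y : T x -> T y -> exists S, [/\ over S, S x & S y].
Proof.
move=> Tx Ty; have [|S oS hS] := @over_common [:: x; y].
  by move=> z; rewrite !inE => /orP[]/eqP->.
by exists S; split=> //; apply: hS; rewrite !inE eqxx ?orbT.
Qed.

Lemma sub_over_union S : over S -> S `<=` T.
Proof. by move=> oS x Sx; exists S. Qed.

Lemma over_unionM x y : T x -> T y -> T (x * y).
Proof.
move=> Tx Ty; have [S [oS Sx Sy]] := over_common2 Tx Ty.
by exists S => //; case: oS => _ _ mS _ _; apply: mS.
Qed.

Lemma base_over_union : B `<=` T.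
Proof. exact: sub_over_union over_base. Qed.

Lemma over_union_submod : is_submodule T.
Proof.
split; first by apply: base_over_union; apply: base0.
- move=> x y Tx Ty; have [S [oS Sx Sy]] := over_common2 Tx Ty.
  by exists S => //; case: oS => sS _ _ _ _; apply: submodD.
- by move=> r x Tx; apply: over_unionM => //; apply: base_over_union; exists r.
Qed.

Lemma over_union1 : T 1.
Proof. by apply: base_over_union; apply: base1. Qed.

Lemma over_unionB x y : T x -> T y -> T (x - y).
Proof. exact: submodB over_union_submod. Qed.

Hypothesis hSM : strong_Mori R.

(** The conductor [D] of [y] into [T] has finite type, so finitely many multiples [r * y] decide;
    they lie in a single [S], which is w-closed and therefore contains [y]. *)
Lemma lw_over_union : lw T `<=` T.
Proof.
move=> y ly; pose D := [set r | B r /\ T (r * y)].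
have sT := over_union_submod.
have sD : is_submodule D.
  split; rewrite /D /=.
  - by rewrite mul0r; split; [exact: base0|exact: (submod0 sT)].
  - move=> a b [Ba Ta] [Bb Tb]; rewrite mulrDl.
    by split; [exact: baseD|exact: (submodD sT)].
  - move=> r a [Ba Ta]; rewrite -mulrA.
    by split; [apply: baseM => //; exists r|apply: (submodM sT) => //; exists r].
have [|s sDs Ds] := finite_type hSM sD; first by apply: bounded_base => r [].
have [|S oS hS] := @over_common [seq r * y | r <- s].
  by move=> _ /mapP[r /sDs[_ Tr] ->].
exists S => //; have [sS _ _ lS _] := oS; apply: lS => M tM.
have [r [Br Mr] Tr] := ly M tM; have [r' or' h] := Ds r (conj Br Tr) M tM.
exists (r' * r); first exact: outsideM.
have : colon S [set y] (r' * r).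
  apply: span_sub h; first exact: colon_submod.
  by move=> q qs _ ->; apply: hS; apply: map_f.
exact.
Qed.

(** Each colon ring of a w-closure is a w-overring. Conversely [S] has finite type, so it is some
    [J^w], and [S] lies in its own colon ring. *)
Lemma w_integral_closureE : w_integral_closure R = T.
Proof.
apply/seteqP; split=> y.
  move=> [J fgJ]; have [/is_idealP[sJ [e Je e0] bJ] _] := fgJ.
  rewrite lwE // => Sy; exists (colon (lw J) (lw J)) => //.
  have sl := lw_submod sJ; split.
  - exact: colon_submod.
  - by move=> z lz; rewrite mul1r.
  - by move=> a b Ca Cb z lz; rewrite -mulrA; apply/Ca/Cb.
  - by apply: lw_colon; apply: lw_id.
  have [d [Bd d0 hd]] := bounded_lw bJ; have le := sub_lw Je.
  exists (d * e); split; [exact: hd|by rewrite mulf_neq0|].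
  by move=> a Ca; rewrite -mulrA [e * a]mulrC; apply/hd/Ca.
move=> [S oS Sy]; have [sS S1 mS lS bS] := oS.
have [s sS' Ss] := finite_type hSM sS bS.
have lE : lw (span_of (1 :: s)) = S.
  apply/seteqP; split=> z.
    by move=> h; apply: lS; apply: lwS h; apply: span_sub => // x /predU1P[->|/sS'].
  move=> /Ss; apply: lwS; apply: span_sub; first exact: submod_span.
  by move=> x xs; apply: mem_span; rewrite in_cons xs orbT.
exists (span_of (1 :: s)).
  by apply: (@fg_ideal_span _ _ 1); rewrite ?mem_head ?oner_neq0.
by rewrite lwE ?lE; [move=> z; apply: mS|exact: submod_span].
Qed.

Hypothesis hB : Boole_w_regular R.

(** The w-closure of [(x, y)] is [g S]. Thus [g] divides both generators, and it is locally a
    combination of them, so every common divisor in the w-closed [T] divides it. *)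
Lemma over_union_gcd x y : x != 0 -> exists g,
  [/\ g != 0, T (x / g), T (y / g)
    & forall c, c != 0 -> T (x / c) -> T (y / c) -> T (g / c)].
Proof.
move=> x0; have [|g [S [g0 oS hS]]] := boole_over hSM hB (I := span_of [:: x; y]).
  by have [] := @fg_ideal_span _ [:: x; y] x (mem_head _ _) x0.
have lS z : z \in [:: x; y] -> T (z / g).
  move=> hz; exists S => //; apply/hS; rewrite mulrC divfK //.
  exact/sub_lw/mem_span.
exists g; split=> //; first by apply: lS; rewrite !inE eqxx.
  by apply: lS; rewrite !inE eqxx orbT.
move=> c c0 xc yc; have [_ S1 _ _ _] := oS.
have lg : lw (span_of [:: x; y]) g by rewrite -[g]mulr1; apply/hS.
apply: lw_over_union => M tM; have [r or h] := lg M tM; exists r => //.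
rewrite mulrA.
have : colon T [set c^-1] (r * g).
  apply: span_sub h; first exact/colon_submod/over_union_submod.
  by move=> z; rewrite !inE => /orP[]/eqP-> _ ->.
exact.
Qed.

End ClosureRing.

(** The cancellation of one power of [x] in [over_union_near], where [w] is [x ^+ (n + k)]. *)
Lemma descent_step (F : fieldType) (x w r r' a a' t t' u : F) : x != 0 ->
  r * (x * w * t) = a + x * (x * w) * u ->
  r' * a = x * (x * w) * t' + x * a' ->
  r' * r * (w * t) = a' + x * w * (t' + r' * u).
Proof.
move=> x0 e e'; apply: (mulfI x0); transitivity (r' * (r * (x * w * t))); first by ring.
by rewrite e mulrDr e'; ring.
Qed.

(** * Local structure at a t-maximal ideal [M = x S] *)

Section AtMaximal.
Variable R : idomainType.
Local Notation K := {fraction R}.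
Local Notation B := (base_ring R).
Local Notation T := (@over_union R).
Implicit Types (I J D : set K) (s : seq K) (y z r t d : K).

Hypotheses (hSM : strong_Mori R) (hB : Boole_w_regular R).

Lemma t_max_over (M : set K) : t_max R M ->
  exists x S, [/\ x != 0, over S & forall y, M (x * y) <-> S y].
Proof.
move=> tM; have [[[idM _] _ _] _] := tM.
have [x [S [x0 oS hS]]] := boole_over hSM hB idM.
exists x, S; split=> // y; rewrite -hS; split; [exact: sub_lw|exact: t_max_lw].
Qed.

Variables (M S : set K) (x : K).
Hypotheses (tM : t_max R M) (x0 : x != 0) (oS : over S)
  (hM : forall y, M (x * y) <-> S y).

Let sM := t_max_submod tM.
Let sS : is_submodule S. Proof. by case: oS. Qed.
Let mS y z : S y -> S z -> S (y * z). Proof. by case: oS => _ _ + _ _; apply. Qed.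
Let BS : B `<=` S. Proof. exact: over_sub_base. Qed.
Let MB : M `<=` B. Proof. exact: t_max_base. Qed.
Let ST : S `<=` T. Proof. exact: sub_over_union. Qed.

Let Mx : M x.
Proof. by rewrite -[x]mulr1; apply/hM; case: oS. Qed.

Let Bx : B x. Proof. exact: MB. Qed.

Let Sx : S x. Proof. exact: BS. Qed.

Let M_div m : M m -> S (m / x).
Proof. by move=> Mm; apply/hM; rewrite mulrC divfK. Qed.

Let M_mul m a : M m -> S a -> M (m * a).
Proof.
move=> /M_div Sm Ss; have -> : m * a = x * (m / x * a).
  by rewrite mulrA [x * _]mulrC divfK.
by apply/hM; apply: mS.
Qed.

(* [S / M] is a finite dimensional vector space over the residue field of [M]:
   vectors witnessing a strict descent are linearly independent. *)
Lemma descending_chain (V : nat -> set K) :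
  (forall k, is_submodule (V k)) -> (forall k, M `<=` V k) ->
  (forall k, V k `<=` S) -> (forall k, V k.+1 `<=` V k) ->
  exists n, forall m, (n <= m)%N -> V m `<=` loc_at M (V m.+1).
Proof.
move=> sV MV VS dV.
have V_le k m : (k <= m)%N -> V m `<=` V k.
  elim: m => [|m IHm]; rewrite leq_eqVlt ?ltnS => /predU1P[->//|]// /IHm.
  exact: subset_trans.
(* [v k] witnesses that [V k] is locally larger than [V k.+1]; it defaults to 0 when it is not. *)
have /choice[v hv] : forall k, exists v, V k v /\
    ((v = 0 /\ V k `<=` loc_at M (V k.+1)) \/ ~ loc_at M (V k.+1) v).
  move=> k; have [h|/existsNP[v /not_implyP[Vv nv]]] :=
    pselect (V k `<=` loc_at M (V k.+1)); last by exists v; split=> //; right.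
  by exists 0; split; [apply: submod0|left].
(* The span of all [v k] has finite type, so for some [N] each [v m] with [m >= N] is locally a
   combination of the first [N] vectors. *)
pose D := [set y | exists n, span_of (mkseq v n) y].
have le_span n m : (n <= m)%N -> span_of (mkseq v n) `<=` span_of (mkseq v m).
  move=> le; apply: span_sub; first exact: submod_span.
  move=> y /mapP[i]; rewrite mem_iota => /andP[_ lt] ->.
  by apply: mem_span; apply: map_f; rewrite mem_iota /= (leq_trans lt).
have sD : is_submodule D.
  split.
  - by exists 0%N; apply: (submod0 (submod_span _)).
  - move=> y z [n yn] [m zm]; exists (n + m)%N.
    apply: (submodD (submod_span _)).
      by apply: le_span yn; apply: leq_addr.
    by apply: le_span zm; apply: leq_addl.
  - move=> r y [n yn]; exists n.
    by apply: (submodM (submod_span _)) => //; exists r.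
have DS : D `<=` S.
  move=> y [n]; apply: span_sub => // z /mapP[i _ ->].
  exact/VS/(hv i).1.
have [|s sDs Ds] := finite_type hSM sD.
  by have [_ _ _ _ [d [Bd d0 hd]]] := oS; exists d; split=> // y /DS/hd.
have [N sN] : exists N, forall y, y \in s -> span_of (mkseq v N) y.
  elim: s sDs {Ds} => [|y s IHs] h; first by exists 0%N.
  have [N hN] := IHs (fun x xs => h x (mem_behead (s := _ :: _) xs)).
  have [n yn] := h y (mem_head _ _); exists (N + n)%N => z /predU1P[->|/hN].
    by apply: le_span yn; apply: leq_addl.
  by apply: le_span; apply: leq_addr.
exists N => m Nm; have [Vm [[]//|bad]] := hv m; case: bad.
have /Ds/(_ M tM)[r' or' h] : D (v m).
  exists m.+1; apply: mem_span; apply: map_f.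
  by rewrite mem_iota add0n ltnS leqnn.
have [c e] := span_sub (submod_span _) sN h.
have nthv (i : 'I_(size (mkseq v N))) : (mkseq v N)`_i = v i.
  by rewrite nth_mkseq // -{2}(size_mkseq v N).
have iN (i : 'I_(size (mkseq v N))) : (i < N)%N by rewrite -{2}(size_mkseq v N).
(* Otherwise [c i] is outside [M] and carries [v i] into [V i.+1]: terms with [j < i] are in [M] by
   induction, while [v m] and the terms with [j > i] are already in [V i.+1]. *)
have Mc i : M (tofrac (c i) * v i).
  have [k] := ubnP (nat_of_ord i); elim: k i => // k IHk i /ltnSE ik.
  have [Vi [[-> _]|nVi]] := hv i; first by rewrite mulr0; apply: submod0.
  apply: contrapT => nM; apply: nVi.
  exists (tofrac (c i)).
    by split; [exists (c i)|move=> Mci; apply/nM/M_mul => //; apply: VS Vi].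
  have -> : tofrac (c i) * v i = r' * v m -
      \sum_(j < size (mkseq v N) | j != i) tofrac (c j) * v j.
    rewrite e (bigD1 i) //= nthv (eq_bigr (fun j => tofrac (c j) * v j)) ?addrK //.
    by move=> j _; rewrite nthv.
  apply: submodB => //.
    apply: submodM => //; first by case: or'.
    by apply: V_le Vm; apply: leq_trans Nm; apply: iN.
  rewrite big_mkcond; apply: submod_sum => // j _; case: ifP => ji; last exact: submod0.
  have [lt|gt|/val_inj eq] := ltngtP j i; last by rewrite eq eqxx in ji.
    by apply: MV; apply: IHk; apply: leq_trans ik.
  apply: submodM => //; first by exists (c j).
  by apply: V_le (hv j).1.
exists r' => //; apply: MV; rewrite e; apply: submod_sum => // i _.
by rewrite nthv.
Qed.

(* The principal ideal theorem argument, with [(c^k S : x^oo)] in place of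
   symbolic powers. *)
Lemma power_in_principal c : B c -> c != 0 ->
  exists m r, outside M r /\ S (r * x ^+ m / c).
Proof.
move=> Bc c0.
pose Q k := [set q | S q /\ exists m, S (x ^+ m * q / c ^+ k)].
have SX m : S (x ^+ m) by apply: BS; apply: baseX.
have sQ k : is_submodule (Q k).
  split.
  - by split; [exact: submod0|exists 0%N; rewrite mulr0 mul0r; apply: submod0].
  - move=> y z [Sy [m hm]] [Sz [n hn]]; split; first exact: submodD.
    exists (m + n)%N; rewrite mulrDr mulrDl; apply: submodD => //.
      by rewrite addnC exprD -!mulrA; apply: mS => //; rewrite mulrA.
    by rewrite exprD -!mulrA; apply: mS => //; rewrite mulrA.
  - move=> r y [Sy [m hm]]; split; first by apply: submodM => //; exists r.
    by exists m; rewrite mulrCA -mulrA; apply: submodM => //; exists r.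
have QS k : Q k.+1 `<=` Q k.
  move=> q [Sq [m hm]]; split=> //; exists m.
  have := mS hm (BS Bc); congr S.
  by rewrite exprS invfM -!mulrA [_ * c]mulrC; congr (_ * (_ * _)); rewrite mulKf.
(* Adding [x S = M] to [Q k] gives a chain to which [descending_chain] applies. *)
pose V k := [set y | exists q t, [/\ Q k q, S t & y = q + x * t]].
have [|||k|n /(_ n (leqnn n)) hn] := @descending_chain V.
- move=> k; split.
  + exists 0, 0; split; [exact: submod0|exact: submod0|by rewrite mulr0 addr0].
  + move=> _ _ [q [t [Qq Ss ->]]] [q' [t' [Qq' Ss' ->]]].
    exists (q + q'), (t + t'); split; [exact: submodD|exact: submodD|].
    by rewrite mulrDr addrACA.
  + move=> a _ [q [t [Qq Ss ->]]]; exists (tofrac a * q), (tofrac a * t).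
    by split; [apply: submodM => //; exists a|apply: submodM => //; exists a|
       rewrite mulrDr mulrCA].
- move=> k m Mm; exists 0, (m / x); split; [exact: submod0|exact: M_div|].
  by rewrite add0r mulrC divfK.
- move=> k y [q [t [[Sq _] Ss ->]]]; apply: submodD => //; exact: mS.
- by move=> y [q [t [Qq Ss ->]]]; exists q, t; split=> //; apply: QS.
have [|s sQs Qs] := finite_type hSM (sQ n).
  by have [_ _ _ _ [d [Bd d0 hd]]] := oS; exists d; split=> // y [/hd].
(* Locally [Q n] lies in [Q n.+1 + x Q n]: the coefficient [t] of [x] returns to [Q n] because [Q n]
   is saturated with respect to [x]. *)
have nak y : y \in s -> loc_at M (Q n.+1) y.
  apply: (@nakayama _ M (Q n.+1) s x) => // {}y /sQs Qy.
  have [|r or [q [t [Qq St e]]]] := hn y.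
    by exists y, 0; split; [|exact: submod0|rewrite mulr0 addr0].
  have Qt : Q n t.
    have : Q n (x * t).
      have -> : x * t = r * y - q by rewrite e addrAC subrr add0r.
      by apply: submodB => //; [apply: submodM => //; case: or|exact: QS].
    move=> [_ [m hm]]; split=> //; exists m.+1.
    by rewrite exprSr -!mulrA [x * _]mulrA mulrA.
  have [r' or' rt] := Qs t Qt M tM.
  exists (r' * r); first exact: outsideM.
  exists (r' * q), (r' * t); split=> //; first by apply: submodM => //; case: or'.
  by rewrite -mulrA e mulrDr mulrCA.
(* Once [c ^+ n] is locally in [Q n.+1], cancelling [c ^+ n] leaves a power of [x] locally in
   [c S]. *)
have Qc : Q n (c ^+ n).
  split; first by apply/BS/baseX.
  by exists 0%N; rewrite expr0 mul1r divff ?expf_neq0 //; case: oS.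
have /(loc_at_id tM)[r or [_ [m hm]]] : loc_at M (loc_at M (Q n.+1)) (c ^+ n).
  have [r or h] := Qs _ Qc M tM; exists r => //.
  by apply: span_sub h => //; apply: loc_at_submod.
exists m, r; split=> //; move: hm; congr S.
by rewrite exprS mulrA -mulf_div divff ?expf_neq0 // mulr1 [x ^+ m * r]mulrC.
Qed.

(** The chain of intersections of [S] with [x^k T + x S] is locally stationary from [n] on. For a
    given [t] some [x^m t] is locally in [S], so the claim holds with exponent [n + m]; stationarity
    lowers it to [n], one unit at a time. *)
Lemma over_union_near : exists n, forall t, T t ->
  exists r a u, [/\ outside M r, S a, T u & r * (x ^+ n * t) = a + x ^+ n.+1 * u].
Proof.
have sT := over_union_submod R.
pose V k := [set y | S y /\ exists t a, [/\ T t, S a & y = x ^+ k * t + x * a]].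
have [|||k|n hn] := @descending_chain V.
- move=> k; split.
  + split; first exact: submod0.
    by exists 0, 0; split; [exact: submod0|exact: submod0|rewrite !mulr0 addr0].
  + move=> y z [Sy [t [a [Tt Sa ey]]]] [Sz [t' [a' [Tt' Sa' ez]]]].
    split; first exact: submodD.
    exists (t + t'), (a + a'); split; [exact: submodD|exact: submodD|].
    by rewrite ey ez !mulrDr addrACA.
  + move=> r y [Sy [t [a [Tt Sa e]]]]; split; first by apply: submodM => //; exists r.
    exists (tofrac r * t), (tofrac r * a).
    by split; [apply: submodM => //; exists r|apply: submodM => //; exists r|
       rewrite e mulrDr !(mulrCA (tofrac r))].
- move=> k m Mm; split; first exact/BS/MB.
  exists 0, (m / x); split; [exact: submod0|exact: M_div|].
  by rewrite mulr0 add0r mulrC divfK.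
- by move=> k y [].
- move=> y [Sy [t [a [Tt Sa e]]]]; split=> //; exists (x * t), a; split=> //.
    by apply: submodM.
  by rewrite e exprSr mulrA.
exists n => t Tt.
have [m [r0 [or0 hm]]] : exists m r, outside M r /\ S (r * x ^+ m * t).
  have [a [b [Ba Bb b0 e]]] := fractionP t.
  have [m [r [or h]]] := power_in_principal Bb b0; exists m, r; split=> //.
  have := mS h (BS Ba); congr S.
  by rewrite -e [t * b]mulrC mulrA divfK.
pose P k := exists r a u,
  [/\ outside M r, S a, T u & r * (x ^+ (n + k) * t) = a + x ^+ (n + k).+1 * u].
suff : P 0%N by rewrite /P addn0.
have : P m.
  exists r0, (x ^+ n * (r0 * x ^+ m * t)), 0; split=> //.
  - by apply: mS => //; apply: BS; apply: baseX.
  - exact: submod0.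
  - by rewrite mulr0 addr0 exprD -!mulrA mulrCA [r0 * _]mulrCA.
elim: m {or0 hm} => [//|k IHk] [r [a [u [or Sa Tu e]]]]; apply: IHk.
have Tr r' : outside M r' -> T r' by case=> Br' _; apply/ST/BS.
(* Here [a = x ^+ (n + k.+1) * (r * t - x * u)] is in the chain at index [n + k.+1], hence locally
   at the next index. *)
have [|r' or' [_ [t' [a' [Tt' Sa' e']]]]] := hn (n + k.+1)%N (leq_addr _ _) a.
  split=> //; exists (r * t - x * u), 0; split; [|exact: submod0|].
    apply: submodB => //; first by apply: submodM => //; case: or.
    exact: submodM.
  by rewrite mulr0 addr0 mulrBr mulrCA e mulrA -exprSr addrK.
exists (r' * r), a', (t' + r' * u); split=> //; first exact: outsideM.
  by apply: submodD => //; apply: submodM => //; case: or'.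
by move: e e'; rewrite addnS !exprS; apply: descent_step.
Qed.

Lemma divisor_acc (P : set K) y : P y ->
  (forall b, P b -> [/\ b != 0, T b & T (x / b)]) ->
  exists2 b, P b & forall b', P b' -> T (b / b') -> T (b' / b).
Proof.
move=> Py hP; have sT := over_union_submod R.
have [n hn] := over_union_near.
pose N b := [set z | T (z / b) /\ S (x ^+ n * z)].
have [_ _ _ lS [d [Bd d0 hd]]] := oS.
have xn0 : x ^+ n != 0 by rewrite expf_neq0.
have [|||I [b Pb <-] maxb] := @noetherian_max _ hSM
    [set N b | b in P] (N y) (d * x ^+ n) _ _ (mulf_neq0 d0 xn0).
- by exists y.
- by apply: baseM => //; apply: baseX.
- move=> _ [b /hP[b0 Tb xb] <-]; split.
  + split.
    * by split; rewrite ?mul0r ?mulr0; apply: submod0.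
    * move=> z w [Tz Sz] [Tw Sw].
      by split; rewrite ?mulrDl ?mulrDr; apply: submodD.
    * move=> r z [Tz Sz]; split; first by rewrite -mulrA; apply: submodM => //; exists r.
      by rewrite mulrCA; apply: submodM => //; exists r.
  + move=> z lz; split.
      apply: (lw_over_union hSM) => M' tM'; have [r or [h _]] := lz M' tM'.
      by exists r; rewrite // mulrA.
    apply: lS => M' tM'; have [r or [_ h]] := lz M' tM'.
    by exists r; rewrite // mulrCA.
  + exists x => //; split=> //; apply: mS => //.
    by apply: BS; apply: baseX.
  + by move=> z [_ Sz]; rewrite -mulrA; apply: hd.
exists b => // b' Pb' Tbb'.
have [b0 Tb xb] := hP b Pb; have [b'0 Tb' xb'] := hP b' Pb'.
have Nbb' : N b' = N b.
  apply: maxb; first by exists b'.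
  move=> z [Tz Sz]; split=> //.
  have := over_unionM Tz Tbb'; congr T.
  by rewrite mulrA divfK.
apply: (lw_over_union hSM) => M' tM'.
have [eq|ne] := pselect (M' = M).
  have [r [a [u [or Sa Tu e]]]] := hn b' Tb'.
  exists r; rewrite ?eq //.
  (* The correction [x * u] brings [r * b'] into [x^-n S], and it lies in [b T] because [b] divides
     [x]. *)
  have : N b' (r * b' - x * u).
    split.
      rewrite mulrBl mulfK //; apply: submodB => //; first by apply/ST/BS; case: or.
      by rewrite mulrAC; apply: over_unionM.
    have -> : x ^+ n * (r * b' - x * u) = a; last by [].
    by rewrite mulrBr mulrCA e mulrA -exprSr addrK.
  rewrite Nbb' => -[h _].
  have := submodD sT h (over_unionM xb Tu); congr T.
  by rewrite mulrBl [x * u / b]mulrAC subrK mulrA.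
(* Away from [M], some [r] in [M] is outside [M']; it is a multiple of [x] in [S], hence of [b] in
   [T]. *)
have [r [Mr nr]] : exists r, M r /\ ~ M' r.
  apply: contrapT => no; apply: ne; apply: (t_max_eq tM tM') => r Mr.
  by apply: contrapT => nr; apply: no; exists r.
exists r; first by split=> //; apply: MB.
have := over_unionM (over_unionM (ST (M_div Mr)) xb) Tb'; congr T.
by rewrite mulrA divfK // mulrA mulrAC.
Qed.

(** Among the divisors of [x] without factorization, one with [b T] maximal is neither a unit nor
    irreducible, and both of its proper factors factor. *)
Lemma factors_generator : factors T x.
Proof.
apply: contrapT => nx.
have TM := @over_unionM R; have T1 := over_union1 R.
pose P := [set b | [/\ b != 0, T b, T (x / b) & ~ factors T b]].
have Px : P x by split=> //; [exact: ST|rewrite divff].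
have [b [b0 Tb xb nb] maxb] : exists2 b, P b &
    forall b', P b' -> T (b / b') -> T (b' / b).
  by apply: divisor_acc Px _ => b [].
have Px_dvd u v : T u -> T v -> b = u * v -> ~ unit_in T v -> factors T u.
  move=> Tu Tv e nv; apply: contrapT => nu; apply: nv.
  move: b0; rewrite e mulf_eq0 negb_or => /andP[u0 v0].
  split=> //; exists v^-1; last by rewrite divff.
  have : T (u / b).
    apply: maxb; last by rewrite e mulrC mulKf.
    split=> //; have := TM _ _ xb Tv; congr T.
    by rewrite e invfM mulrA divfK.
  by rewrite e invfM mulrA divff ?mul1r.
apply: nb; apply: contrapT => nb.
have [ib|] := pselect (irreducible_in T b); first by apply: nb; apply: factors_irr.
apply; split=> // [Ub|u v Tu Tv e]; first by apply: nb; apply: factors_unit.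
apply: contrapT => /not_orP[nu nv]; apply: nb; rewrite e.
apply: factorsM => //; first exact: (Px_dvd u v).
by apply: (Px_dvd v u); rewrite // mulrC.
Qed.

End AtMaximal.

(** * Noetherian induction: every nonzero element divides a product of irreducibles *)

Section Main.
Variable R : idomainType.
Local Notation K := {fraction R}.
Local Notation B := (base_ring R).
Local Notation T := (@over_union R).
Implicit Types (I J M S : set K) (s : seq K) (x y z r t : K).

Hypotheses (hSM : strong_Mori R) (hB : Boole_w_regular R).

Definition dvd_prod_irr t := exists2 s, all_irr T s & T (\prod_(p <- s) p / t).

(** A maximal counterexample [I] is proper, so it lies in some [M = x S]. The colon of [I] by [M]
    cannot be larger, since it would handle [t / x], and [x] factors. But if it equals [I], powers
    of [x] can be stripped until an element outside [M] is in [I]. *)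
Lemma w_ideal_dvd_prod_irr I t : is_submodule I -> I `<=` B -> lw I `<=` I ->
  (exists2 y, I y & y != 0) -> t != 0 -> (forall y, I y -> T (y / t)) ->
  dvd_prod_irr t.
Proof.
move=> sI IB lI nI t0 It; apply: contrapT => nt.
have TM := @over_unionM R.
pose C := [set I | [/\ is_submodule I, I `<=` B, lw I `<=` I & exists2 y, I y & y != 0] /\
  exists t, [/\ t != 0, forall y, I y -> T (y / t) & ~ dvd_prod_irr t]].
have [||||{}I [[{}sI {}IB {}lI {}nI] [{nt It t0}t [t0 It nt]]] maxI] :=
    @noetherian_max _ hSM C I 1.
- by split=> //; exists t.
- exact: base1.
- exact: oner_neq0.
- by move=> J [[sJ JB lJ nJ] _]; split=> // y Jy; rewrite mul1r; apply: JB.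
have nI1 : ~ I 1.
  move=> /It I1; apply: nt; exists [::] => [p //|].
  by rewrite big_nil.
have [M tM IM] : exists2 M, t_max R M & I `<=` M.
  apply: contrapT => no; apply: nI1; apply: lI => M tM.
  have [r [Ir Mr]] : exists r, I r /\ ~ M r.
    apply: contrapT => h; apply: no; exists M => // r Ir.
    by apply: contrapT => Mr; apply: h; exists r.
  by exists r; [split=> //; apply: IB|rewrite mulr1].
have [x [S [x0 oS hM]]] := t_max_over hSM hB tM.
have [sS S1 mS lS _] := oS.
have Mx : M x by rewrite -[x]mulr1; apply/hM.
have MB := t_max_base tM; have sM := t_max_submod tM.
pose J := [set r | B r /\ forall m, M m -> I (r * m)].
have IJ : I `<=` J.
  move=> r Ir; split=> [|m Mm]; first exact: IB.
  by rewrite mulrC; apply: submodM => //; apply: MB.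
have CJ : C J.
  split.
    split.
    - split.
      + by split=> [|m Mm]; rewrite ?mul0r; [exact: base0|exact: submod0].
      + move=> a b [Ba Ia] [Bb Ib]; split=> [|m Mm]; first exact: baseD.
        by rewrite mulrDl; apply: submodD => //; [apply: Ia|apply: Ib].
      + move=> r a [Ba Ia]; split=> [|m Mm]; first by apply: baseM => //; exists r.
        by rewrite -mulrA; apply: submodM => //; [exists r|apply: Ia].
    - by move=> r [].
    - move=> r lr; split=> [|m Mm].
        by rewrite -lw_base; apply: lwS lr => a [].
      apply: lI => M' tM'; have [a oa [_ h]] := lr M' tM'.
      by exists a => //; rewrite mulrA; apply: h.
    - by have [y Iy y0] := nI; exists y => //; apply: IJ.
  (* [x J] is contained in [I], so [t / x] divides every element of [J]. *)
  exists (t / x); split; first by rewrite mulf_neq0 ?invr_eq0.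
    by move=> y [_ /(_ x Mx) /It]; rewrite invf_div mulrA.
  move=> [s hs h]; apply: nt.
  have [u [s' [Uu hs' ex]]] := factors_generator hSM tM x0 oS hM.
  exists (s' ++ s); first exact: all_irr_cat.
  have [Tu' _] := unitV Uu; have := TM _ _ Tu' h; congr T.
  rewrite big_cat /= invf_div ex mulrCA -[u * _ / t]mulrA mulKf ?(unit_neq0 Uu) //.
  by rewrite mulrCA mulrA.
have eJ := maxI _ CJ IJ.
have [c Ic c0] := nI.
have [m [r [[Br Mr] h]]] := power_in_principal hSM tM x0 oS hM (IB _ Ic) c0.
have Sx k : S (x ^+ k) by apply: (over_sub_base oS); apply/baseX/MB.
suff rI : forall a, S a -> I (r * x * a).
  apply/Mr/IM; rewrite -eJ; split=> // b Mb.
  have Sb : S (b / x) by apply/hM; rewrite mulrC divfK.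
  by have := rI _ Sb; congr I; rewrite -mulrA [x * _]mulrC divfK.
(* One extra factor [x] moves the cofactor of [c] from [S] into [M], hence into [B], so that the
   product is in [I]. *)
have : forall a, S a -> I (r * x ^+ m.+1 * a).
  move=> a Sa; have Mh : M (x * (r * x ^+ m / c * a)) by apply/hM/mS.
  have := submodM sI (MB _ Mh) Ic; congr I.
  by rewrite -mulrA [_ * a * c]mulrAC divfK // exprS [r * (x * _)]mulrCA -!mulrA.
(* Multiplication by [M = x S] restores the removed power of [x]; so the element with lower exponent
   is in [J], which is [I]. *)
elim: m {h} => [|m IHm] h; first by rewrite expr1 in h.
apply: IHm => a Sa; rewrite -eJ; split=> [|b Mb].
  rewrite -mulrA; apply: baseM => //; apply: MB.
  by rewrite exprS -mulrA; apply/hM/mS.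
have Sb : S (b / x) by apply/hM; rewrite mulrC divfK.
have := h _ (mS _ _ Sa Sb); congr I.
by rewrite exprSr -!mulrA (mulrCA x a) [x * (b / x)]mulrC divfK.
Qed.

(** With [y = a / b], the principal w-ideal [a B] lies in [y T], since [a = y * b]. *)
Lemma over_union_dvd_prod_irr y : T y -> y != 0 -> dvd_prod_irr y.
Proof.
move=> Ty y0; have [a [b [Ba Bb b0 e]]] := fractionP y.
have a0 : a != 0 by rewrite -e mulf_neq0.
have BT := @base_over_union R.
pose I := [set z | B (z / a)].
apply: (@w_ideal_dvd_prod_irr I) => //.
- split; rewrite /I /=.
  + by rewrite mul0r; apply: base0.
  + by move=> z w Bz Bw; rewrite mulrDl; apply: baseD.
  + by move=> r z Bz; rewrite -mulrA; apply: baseM => //; exists r.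
- by move=> z Bz; rewrite -(divfK a0 z); apply: baseM.
- move=> z lz; rewrite /I /= -lw_base => M tM; have [r or h] := lz M tM.
  by exists r => //; rewrite mulrA.
- by exists a => //; rewrite /I /= divff //; apply: base1.
move=> z Bz; have := over_unionM (BT _ Bz) (BT _ Bb); congr T.
by rewrite -e invfM mulrA divfK.
Qed.

End Main.

Theorem proposition3p12 (R : idomainType) (hSM : strong_Mori R)
  (hB : Boole_w_regular R) : is_UFD (w_integral_closure R).
Proof.
rewrite w_integral_closureE //; apply: gcd_domain_UFD.
- exact: over_union1.
- exact: over_unionB.
- exact: over_unionM.
- exact: over_union_gcd.
- exact: over_union_dvd_prod_irr.
Qed.
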